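(* With the mesh, data and operators of the context, let $\sigma>0$, $\tau\in(0,2)$, and let $\bm q^{(0)},\bm\alpha^{(0)}\in\mathbb{R}^{\mathbf V^{\mathrm{st}}}\times\mathbb{R}^{3\times\mathbf T^{\mathrm c}}$ and $\bm\beta^{(0)}\in\mathbb{R}^{\mathbf V^{\mathrm{st}}}\times(\mathbb{R}^{3\times\mathbf T^{\mathrm{st}}})^6\times\mathbb{R}^{\mathbf V^{\mathrm{st}}}$ be arbitrary. Let $\{(\bm\varphi^{(l)};\bm z^{(l)};\bm q^{(l)};\bm\alpha^{(l)};\bm\beta^{(l)})\}$ be the sequence generated, for $l=0,1,2,\dots$, by $$\begin{aligned}(\bm\varphi^{(l+1)},\bm z^{(l+1)})&=\arg\min_{\bm\varphi,\bm z}\big\{\mathfrak L_\sigma(\bm\varphi,\bm z,\bm q^{(l)};\bm\alpha^{(l)},\bm\beta^{(l)})\mid\bm\varphi\in\mathrm{rge}(\mathcal A^* )\big\},\\ \bm q^{(l+1)}&=\arg\min_{\bm q}\ \mathfrak L_\sigma(\bm\varphi^{(l+1)},\bm z^{(l+1)},\bm q;\bm\alpha^{(l)},\bm\beta^{(l)}),\\ \bm\alpha^{(l+1)}&=\bm\alpha^{(l)}+\tau\sigma\big(\mathcal A\bm\varphi^{(l+1)}-\bm q^{(l+1)}\big),\\ \bm\beta^{(l+1)}&=\bm\beta^{(l)}+\tau\sigma\big(\bm z^{(l+1)}-\mathcal B\mathcal F\bm q^{(l+1)}-\bm d\big),\end{aligned}$$ where $$\mathfrak L_\sigma(\bm\varphi,\bm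 z,\bm q;\bm\alpha,\bm\beta)=\langle\bm c,\bm\varphi\rangle_{\mathrm c,V}+\delta_{\mathbb Q}(\mathcal T\bm z)+\langle\mathcal A\bm\varphi-\bm q,\bm\alpha\rangle_q+\langle\bm z-\mathcal B\mathcal F\bm q-\bm d,\bm\beta\rangle_z+\tfrac\sigma2\|\mathcal A\bm\varphi-\bm q\|_q^2+\tfrac\sigma2\|\bm z-\mathcal B\mathcal F\bm q-\bm d\|_z^2.$$ Then the whole sequence $\{(\bm\varphi^{(l)};\bm z^{(l)};\bm q^{(l)};\bm\alpha^{(l)};\bm\beta^{(l)})\}$ converges to a solution $(\bm\varphi;\bm z;\bm q;\bm\alpha;\bm\beta)$, $\bm\alpha=(\bm\alpha_1;\bm\alpha_2)$, of the KKT system $$\begin{cases}\mathcal A\bm\varphi=\bm q,\quad \mathcal B\mathcal F\bm q+\bm d=\bm z,\\ \mathcal W_{\mathrm c,V}\bm c+\mathcal A^*(\mathcal W_{\mathrm{st},V}\bm\alpha_1;\mathcal W_{\mathrm c,T}\bm\alpha_2)=0,\\ (\mathcal W_{\mathrm{st},V}\bm\alpha_1;\mathcal W_{\mathrm c,T}\bm\alpha_2)+\mathcal F^*\mathcal B^*\,\mathrm{Diag}(\mathcal W_{\mathrm{st},V},\mathcal I_6\otimes\mathcal W_{\mathrm{st},T},\mathcal W_{\mathrm{st},V})\bm\beta=0,\\ \mathcal T\bm z\in\mathbb Q,\quad \mathrm{Diag}(\mathcal W_{\mathrm{st},V},\mathcal I_6\otimes\mathcal W_{\mathrm{st},T},\mathcal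 W_{\mathrm{st},V})\bm\beta\in\mathcal T^*\mathbb Q,\quad\langle\bm\beta,\bm z\rangle_z=0\end{cases}$$ of the second-order cone program $\min_{\bm\varphi,\bm q,\bm z}\{\langle\bm\varphi,\bm c\rangle_{\mathrm c,V}\mid\mathcal A\bm\varphi=\bm q,\ \mathcal B\mathcal F\bm q+\bm d=\bm z,\ \mathcal T\bm z\in\mathbb Q\}$.
   Context: Mesh. $V=\{\bm v_1,\dots,\bm v_{|V|}\}\subset\mathbb{R}^3$ is a finite set of vertices and $T=\{\bm f_1,\dots,\bm f_{|T|}\}$ a finite set of nondegenerate closed triangles with vertices in $V$. Any two distinct triangles meet in the empty set, a common vertex or a common edge; every vertex belongs to at least one triangle; the mesh is connected (the union of the triangles is connected). $T_{\bm v}$ is the set of triangles having $\bm v$ as a vertex, $|\bm f|$ the area of $\bm f$, $|\bm v|:=\frac13\sum_{\bm f\in T_{\bm v}}|\bm f|$. For each $\bm f\in T$ an ordering $\bm v_1^{\bm f},\bm v_2^{\bm f},\bm v_3^{\bm f}$ of its vertices is fixed, and $T_{\bm v,i}:=\{\bm f\in T_{\bm v}\mid\bm v_i^{\bm f}=\bm v\}$, $i=1,2,3$, with elements listed in order as $\bm f_1^{\bm v,i},\dots,\bm f_{|T_{\bm v,i}|}^{\bm v,i}$. Index sets. $N\ge1$ is an integer, $\mathcal G^{\mathrm c}=\{0,1,\dots,N\}$, $\mathcal G^{\mathrm{st}}=\{\frac12,\frac32,\dots,N-\frac12\}$, $\mathbf V^{\mathrm c}=\mathcal G^{\mathrm c}\times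 V$, $\mathbf V^{\mathrm{st}}=\mathcal G^{\mathrm{st}}\times V$, $\mathbf T^{\mathrm c}=\mathcal G^{\mathrm c}\times T$, $\mathbf T^{\mathrm{st}}=\mathcal G^{\mathrm{st}}\times T$, ordered lexicographically with time first. $\mathbb{R}^{3\times\mathbf T^{\mathrm c}}$, $\mathbb{R}^{3\times\mathbf T^{\mathrm{st}}}$ are the spaces of families of vectors in $\mathbb{R}^3$ indexed by $\mathbf T^{\mathrm c}$, $\mathbf T^{\mathrm{st}}$. $(\cdot;\cdot)$ is vertical stacking, $\mathrm{Diag}$ a block-diagonal matrix with (possibly rectangular) blocks, $\mathcal I_n$ the identity, $\otimes$ the Kronecker product, $\bm 0_n,\bm 1_n$ the all-zeros and all-ones vectors, $\mathrm{rge}$ the range. $\mathcal A^*,\mathcal F^*,\mathcal B^*,\mathcal T^*$ are Euclidean adjoints (transposes). $\delta_{\mathbb Q}$ is the indicator function of $\mathbb Q$ ($0$ on $\mathbb Q$, $+\infty$ elsewhere). Variables: $\bm\varphi\in\mathbb{R}^{\mathbf V^{\mathrm c}}$; $\bm q,\bm\alpha\in\mathbb{R}^{\mathbf V^{\mathrm{st}}}\times\mathbb{R}^{3\times\mathbf T^{\mathrm c}}$; $\bm z,\bm\beta\in\mathbb{R}^{\mathbf V^{\mathrm{st}}}\times(\mathbb{R}^{3\times\mathbf T^{\mathrm{st}}})^6\times\mathbb{R}^{\mathbf V^{\mathrm{st}}}$. Discrete gradient. $\mathcal A=(\mathcal A_t;\mathcal A_s):\mathbb{R}^{\mathbf V^{\mathrm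 c}}\to\mathbb{R}^{\mathbf V^{\mathrm{st}}}\times\mathbb{R}^{3\times\mathbf T^{\mathrm c}}$ with $(\mathcal A_t\bm\varphi)_{k,\bm v}=N(\varphi_{k+\frac12,\bm v}-\varphi_{k-\frac12,\bm v})$ and $(\mathcal A_s\bm\varphi)_{k,\bm f}=\sum_{i=1}^3\varphi_{k,\bm v_i^{\bm f}}\nabla h_{\bm v_i^{\bm f}}$, where on the triangle $\bm f$ $$(\nabla h_{\bm v_1^{\bm f}},\nabla h_{\bm v_2^{\bm f}},\nabla h_{\bm v_3^{\bm f}})=J_{\bm f}(J_{\bm f}^\top J_{\bm f})^{-1}\begin{pmatrix}-1&1&0\\-1&0&1\end{pmatrix},\quad J_{\bm f}=(\bm v_2^{\bm f}-\bm v_1^{\bm f},\ \bm v_3^{\bm f}-\bm v_1^{\bm f}).$$ Weights. $\mathcal W_{\mathrm c,V}$, $\mathcal W_{\mathrm{st},V}$ multiply the $(k,\bm v)$ component by $|\bm v|/N$ on $\mathbb{R}^{\mathbf V^{\mathrm c}}$, $\mathbb{R}^{\mathbf V^{\mathrm{st}}}$; $\mathcal W_{\mathrm c,T}$, $\mathcal W_{\mathrm{st},T}$ multiply the $(k,\bm f)$ component by $|\bm f|/N$ on $\mathbb{R}^{3\times\mathbf T^{\mathrm c}}$, $\mathbb{R}^{3\times\mathbf T^{\mathrm{st}}}$. Inner products: $\langle\bm x,\hat{\bm x}\rangle_{\mathrm c,V}:=\langle\bm x,\mathcal W_{\mathrm c,V}\hat{\bm x}\rangle$, $\langle\bm\alpha,\bm\alpha'\rangle_q:=\langle\bm\alpha,\mathrm{Diag}(\mathcal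 W_{\mathrm{st},V},\mathcal W_{\mathrm c,T})\bm\alpha'\rangle$, $\langle\bm\beta,\bm\beta'\rangle_z:=\langle\bm\beta,\mathrm{Diag}(\mathcal W_{\mathrm{st},V},\mathcal I_6\otimes\mathcal W_{\mathrm{st},T},\mathcal W_{\mathrm{st},V})\bm\beta'\rangle$; $\|\cdot\|_q,\|\cdot\|_z$ are the induced norms. Given $\bm\mu_0,\bm\mu_N\in\{\bm\mu\in\mathbb{R}^{|V|}_+\mid\sum_{\bm v}|\bm v|\mu_{\bm v}=1\}$, the vector $\bm c\in\mathbb{R}^{\mathbf V^{\mathrm c}}$ is determined by $\langle\bm\varphi,\bm c\rangle_{\mathrm c,V}=\sum_{\bm v}|\bm v|\varphi_{0,\bm v}\mu_{0,\bm v}-\sum_{\bm v}|\bm v|\varphi_{N,\bm v}\mu_{N,\bm v}$ for all $\bm\varphi$. SOCP operators. $\mathcal F(\bm A;\bm B)=(\bm A;\bm D_1^-;\bm D_2^-;\bm D_3^-;\bm D_1^+;\bm D_2^+;\bm D_3^+)$ with $\bm D_i^\pm\in\mathbb{R}^{3\times\mathbf T^{\mathrm{st}}}$, $(\bm D_i^\pm)_{k,\bm f}=\bm B_{k\pm\frac12,\bm f}$, $i=1,2,3$. $\mathcal B(\bm x;\bm y)=(-\bm x;\frac{\sqrt3}3\bm y;\bm x)$ for $\bm x\in\mathbb{R}^{\mathbf V^{\mathrm{st}}}$, $\bm y\in(\mathbb{R}^{3\times\mathbf T^{\mathrm{st}}})^6$. $\bm d=(\bm 1_{|\mathbf V^{\mathrm{st}}|};\bm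 0_{18|\mathbf T^{\mathrm{st}}|};\bm 1_{|\mathbf V^{\mathrm{st}}|})$. For $(k,\bm v)\in\mathbf V^{\mathrm{st}}$, $\mathcal T_i^{k,\bm v}\bm D:=\big(\sqrt{|\bm f_1^{\bm v,i}|/|\bm v|}\,\bm D_{k,\bm f_1^{\bm v,i}};\dots;\sqrt{|\bm f^{\bm v,i}_{|T_{\bm v,i}|}|/|\bm v|}\,\bm D_{k,\bm f^{\bm v,i}_{|T_{\bm v,i}|}}\big)\in\mathbb{R}^{3|T_{\bm v,i}|}$ for $\bm D\in\mathbb{R}^{3\times\mathbf T^{\mathrm{st}}}$; $\mathcal T^{k,\bm v}:=\mathrm{Diag}(\bm e_{k,\bm v}^\top,\mathcal T_1^{k,\bm v},\mathcal T_2^{k,\bm v},\mathcal T_3^{k,\bm v},\mathcal T_1^{k,\bm v},\mathcal T_2^{k,\bm v},\mathcal T_3^{k,\bm v},\bm e_{k,\bm v}^\top)$, with $\bm e_{k,\bm v}\in\mathbb{R}^{\mathbf V^{\mathrm{st}}}$ the unit vector at $(k,\bm v)$; $\mathcal T\bm z$ is the stacking of $\mathcal T^{k,\bm v}\bm z$ over $(k,\bm v)\in\mathbf V^{\mathrm{st}}$ in lexicographic order (time first). $\mathbb Q:=\prod_{(k,\bm v)\in\mathbf V^{\mathrm{st}}}\mathbb K^{k,\bm v}_{\mathrm{soc}}$ (same order), where $\mathbb K^{k,\bm v}_{\mathrm{soc}}=\{\bm y=(y_0;\bar{\bm y})\in\mathbb{R}^{2+6|T_{\bm v}|}\mid y_0\ge\|\bar{\bm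 y}\|\}$, $y_0$ being the first component and $\bar{\bm y}$ the remaining ones. *)

(* Defs.v *)
From HB Require Import structures.
From mathcomp Require Import all_boot all_order all_algebra.
From mathcomp Require Import all_classical all_reals all_analysis.

Set Implicit Arguments.
Unset Strict Implicit.
Unset Printing Implicit Defensive.

Import Order.TTheory GRing.Theory Num.Theory.
Import numFieldNormedType.Exports.
Local Open Scope classical_set_scope.
Local Open Scope ring_scope.

(* A Euclidean space is the space [I -> R] of real families over a finite type
   [I], with its standard basis indexed by [I].  A Cartesian product of such
   spaces, with vertical stacking, is the space over the sum of the index
   types, and a family of vectors of R^3 over [J] is a real family over
   [J * 'I_3]. *)

Section Euclidean.
Context {R : realType}.

Definition dot {I : finType} (x y : I -> R) : R := \sum_i x i * y i.

Definition enorm {I : finType} (x : I -> R) : R := Num.sqrt (dot x x).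

Definition unit_vec {I : finType} (i : I) : I -> R := fun j => (j == i)%:R.

(* The transpose of the matrix of [L] in the standard bases; it is meant for
   linear [L] only. *)
Definition adj {I J : finType} (L : (I -> R) -> (J -> R)) (y : J -> R) : I -> R :=
  fun i => dot (L (unit_vec i)) y.

Lemma adjP (I J : finType) (L : (I -> R) -> (J -> R)) (x : I -> R) (y : J -> R) :
  linear L -> dot (L x) y = dot x (adj L y).
Proof.
move=> linL.
have scaleE (K : finType) (a : R) (u : K -> R) k : (a *: u) k = a * u k by [].
have L0 : L 0 = 0.
  by have := linL 1 0 0; rewrite !scale1r addr0 -{1}[L 0]addr0 => /addrI.
have Lsum (r : seq I) : L (\sum_(i <- r) x i *: unit_vec i)
    = \sum_(i <- r) x i *: L (unit_vec i).
  elim: r => [|i r IH]; first by rewrite !big_nil.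
  by rewrite !big_cons linL IH.
have xE : x = \sum_i x i *: unit_vec i.
  apply/funext => j; rewrite fct_sumE (bigD1 j) //= big1 => [|i ij].
    by rewrite scaleE /unit_vec eqxx addr0 mulr1.
  by rewrite scaleE /unit_vec eq_sym (negbTE ij) mulr0.
rewrite {1}xE Lsum /dot.
under eq_bigr do rewrite fct_sumE mulr_suml.
rewrite exchange_big /=; apply: eq_bigr => i _.
by rewrite /adj /dot mulr_sumr; apply: eq_bigr => j _; rewrite scaleE mulrA.
Qed.

Definition stack {I J : Type} (x : I -> R) (y : J -> R) : I + J -> R :=
  fun s => match s with inl i => x i | inr j => y j end.
Definition fst_part {I J : Type} (x : I + J -> R) : I -> R := fun i => x (inl i).
Definition snd_part {I J : Type} (x : I + J -> R) : J -> R := fun j => x (inr j).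

Definition diag {I J I' J' : Type} (K : (I -> R) -> (I' -> R))
  (L : (J -> R) -> (J' -> R)) (x : I + J -> R) : I' + J' -> R :=
  stack (K (fst_part x)) (L (snd_part x)).

(* The indicator function of [Q], 0 on [Q] and +oo elsewhere. *)
Definition indicator {X : Type} (Q : set X) (x : X) : \bar R :=
  if `[< Q x >] then 0%E else +oo%E.

Definition is_argmin {X : Type} (D : set X) (f : X -> \bar R) (x : X) : Prop :=
  D x /\ forall y, D y -> (f x <= f y)%E.

End Euclidean.

(* [vertex] and [face] index the vertices and the triangles, and
   [corner f 0, corner f 1, corner f 2] is the ordering fixed on [f]. *)
Record mesh_data (R : realType) := MeshData {
  vertex : finType;
  face : finType;
  pos : vertex -> 'cV[R]_3;
  corner : face -> 'I_3 -> vertex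
}.
Arguments vertex {R} m.
Arguments face {R} m.
Arguments pos {R} [m] v.
Arguments corner {R} [m] f i.

Section Mesh.
Context {R : realType} {M : mesh_data R}.
Local Notation V := (vertex M).
Local Notation T := (face M).

Definition segment (a b : 'cV[R]_3) : set 'cV[R]_3 :=
  [set x | exists2 t : R, 0 <= t <= 1 & x = (1 - t) *: a + t *: b].

Definition triangle (f : T) : set 'cV[R]_3 :=
  [set x | exists t : 'I_3 -> R, [/\ forall i, 0 <= t i, \sum_i t i = 1 &
    x = \sum_i t i *: pos (corner f i)]].

Definition jac (f : T) : 'M[R]_(3, 2) :=
  row_mx (pos (corner f 1) - pos (corner f 0))
         (pos (corner f 2) - pos (corner f 0)).

(* Half the area of the parallelogram spanned by the columns of [jac f]. *)
Definition area (f : T) : R := Num.sqrt (\det ((jac f)^T *m jac f)) / 2.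

Definition star (v : V) : {set T} := [set f | [exists i, corner f i == v]].

Definition varea (v : V) : R := 3^-1 * \sum_(f in star v) area f.

(* Column [i] is the gradient on [f] of the hat function of [corner f i]. *)
Definition hat_grad (f : T) : 'M[R]_3 :=
  jac f *m invmx ((jac f)^T *m jac f) *m
    (row_mx (const_mx (-1) : 'cV[R]_2) 1%:M : 'M[R]_(2, 3)).

End Mesh.

(* By [mesh_meet], two distinct indices stand for two distinct triangles. *)
Record is_mesh (R : realType) (M : mesh_data R) : Prop := IsMesh {
  mesh_pos : injective (@pos R M);
  mesh_nondegenerate : forall f : face M, \rank (jac f) = 2%N;
  mesh_meet : forall f g : face M, f != g ->
    [\/ triangle f `&` triangle g = set0,
        exists i j, corner f i = corner g j /\
          triangle f `&` triangle g = [set pos (corner f i)] |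
        exists i i' j j', [/\ i != i', corner f i = corner g j,
          corner f i' = corner g j' &
          triangle f `&` triangle g =
            segment (pos (corner f i)) (pos (corner f i'))]];
  mesh_cover : forall v : vertex M, exists f i, corner f i = v;
  mesh_connected : connected (\bigcup_(f in [set: face M]) triangle f)
}.

Definition is_density (R : realType) (M : mesh_data R) (mu : vertex M -> R) : Prop :=
  (forall v, 0 <= mu v) /\ \sum_v varea v * mu v = 1.

Section SOCP.
Context {R : realType} {M : mesh_data R} {N : nat}.
Local Notation V := (vertex M).
Local Notation T := (face M).

(* [k : 'I_N] stands for the staggered time k + 1/2, whose centered neighbours
   are k and k + 1. *)
Definition before (k : 'I_N) : 'I_N.+1 := widen_ord (leqnSn N) k.
Definition after (k : 'I_N) : 'I_N.+1 := lift ord0 k.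

Definition Vc : finType := ('I_N.+1 * V)%type.
Definition Vst : finType := ('I_N * V)%type.
Definition Tc : finType := ('I_N.+1 * T)%type.
Definition Tst : finType := ('I_N * T)%type.
Definition Tc3 : finType := (Tc * 'I_3)%type.
Definition Tst3 : finType := (Tst * 'I_3)%type.

(* [(false, i)] and [(true, i)] are the indices of D_i^- and of D_i^+. *)
Definition six : finType := (bool * 'I_3)%type.

Definition qI : finType := (Vst + Tc3)%type.
Definition fI : finType := (Vst + six * Tst3)%type.
Definition zI : finType := (Vst + (six * Tst3 + Vst))%type.

Definition opAt (phi : Vc -> R) : Vst -> R :=
  fun '(k, v) => N%:R * (phi (after k, v) - phi (before k, v)).
Definition opAs (phi : Vc -> R) : Tc3 -> R :=
  fun '((k, f), a) => \sum_(i < 3) phi (k, corner f i) * hat_grad f a i.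
Definition opA (phi : Vc -> R) : qI -> R := stack (opAt phi) (opAs phi).

Definition WcV (x : Vc -> R) : Vc -> R := fun '(k, v) => varea v / N%:R * x (k, v).
Definition WstV (x : Vst -> R) : Vst -> R := fun '(k, v) => varea v / N%:R * x (k, v).
Definition WcT (x : Tc3 -> R) : Tc3 -> R :=
  fun '((k, f), a) => area f / N%:R * x ((k, f), a).
Definition WstT (x : Tst3 -> R) : Tst3 -> R :=
  fun '((k, f), a) => area f / N%:R * x ((k, f), a).
(* The operator I_6 (x) WstT. *)
Definition W6stT (x : six * Tst3 -> R) : six * Tst3 -> R :=
  fun '(s, j) => WstT (fun j' => x (s, j')) j.

Definition Wq : (qI -> R) -> (qI -> R) := diag WstV WcT.
Definition Wz : (zI -> R) -> (zI -> R) := diag WstV (diag W6stT WstV).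

Definition dot_cV (x y : Vc -> R) : R := dot x (WcV y).
Definition dot_q (x y : qI -> R) : R := dot x (Wq y).
Definition dot_z (x y : zI -> R) : R := dot x (Wz y).
Definition norm_q (x : qI -> R) : R := Num.sqrt (dot_q x x).
Definition norm_z (x : zI -> R) : R := Num.sqrt (dot_z x x).

Definition opF (q : qI -> R) : fI -> R :=
  stack (fst_part q) (fun '((s, i), ((k, f), a)) =>
    snd_part q (((if s then after k else before k), f), a)).

Definition opB (x : fI -> R) : zI -> R :=
  stack (- fst_part x) (stack ((Num.sqrt 3 / 3) *: snd_part x) (fst_part x)).

Definition vd : zI -> R := stack (fun=> 1) (stack (fun=> 0) (fun=> 1)).

(* The index type of R^(2 + 6 |T_v|): besides the first and the last component,
   it has the coordinates of D_i^- and of D_i^+ on the triangles of T_(v,i). *)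
Definition blockI (v : V) : finType :=
  (unit + ({x : six * (T * 'I_3) | corner x.2.1 x.1.2 == v} + unit))%type.

Definition opTkv (kv : Vst) (z : zI -> R) : blockI kv.2 -> R :=
  stack (fun=> fst_part z kv)
    (stack (fun x => let: (s, (f, a)) := val x in
              Num.sqrt (area f / varea kv.2) * fst_part (snd_part z) (s, ((kv.1, f), a)))
           (fun=> snd_part (snd_part z) kv)).

Definition TI : finType := {kv : Vst & blockI kv.2}.

Definition opT (z : zI -> R) : TI -> R := fun p => opTkv z (tagged p).

Definition soc (v : V) : set (blockI v -> R) :=
  [set y | enorm (snd_part y) <= fst_part y tt].

Definition coneQ : set (TI -> R) :=
  [set y | forall kv : Vst, @soc kv.2 (fun j => y (Tagged (fun kv => blockI kv.2) j))].

Definition aug_lagrangian (c : Vc -> R) (sigma : R) (phi : Vc -> R)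
    (z : zI -> R) (q : qI -> R) (alpha : qI -> R) (beta : zI -> R) : \bar R :=
  ((dot_cV c phi)%:E + indicator coneQ (opT z)
   + (dot_q (opA phi - q) alpha)%:E
   + (dot_z (z - opB (opF q) - vd) beta)%:E
   + (sigma / 2 * norm_q (opA phi - q) ^+ 2)%:E
   + (sigma / 2 * norm_z (z - opB (opF q) - vd) ^+ 2)%:E)%E.

Record is_KKT (c phi : Vc -> R) (z : zI -> R) (q : qI -> R) (alpha : qI -> R)
    (beta : zI -> R) : Prop := IsKKT {
  kkt_A : opA phi = q;
  kkt_BF : opB (opF q) + vd = z;
  kkt_phi : WcV c + adj opA (stack (WstV (fst_part alpha)) (WcT (snd_part alpha))) = 0;
  kkt_q : stack (WstV (fst_part alpha)) (WcT (snd_part alpha))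
    + adj opF (adj opB (Wz beta)) = 0;
  kkt_primal : coneQ (opT z);
  kkt_dual : (adj opT @` coneQ) (Wz beta);
  kkt_compl : dot_z beta z = 0
}.

End SOCP.
Arguments Vc {R} M N.
Arguments Vst {R} M N.
Arguments Tc {R} M N.
Arguments Tst {R} M N.
Arguments Tc3 {R} M N.
Arguments Tst3 {R} M N.
Arguments qI {R} M N.
Arguments fI {R} M N.
Arguments zI {R} M N.
Arguments TI {R} M N.

(* Main.v *)
Require Import Defs.
From HB Require Import structures.
From mathcomp Require Import all_boot all_order all_algebra.
From mathcomp Require Import all_classical all_reals all_analysis.
From mathcomp Require Import ring lra.

Set Implicit Arguments.
Unset Strict Implicit.
Unset Printing Implicit Defensive.

Import Order.TTheory GRing.Theory Num.Theory.
Import numFieldNormedType.Exports.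
Local Open Scope classical_set_scope.
Local Open Scope ring_scope.

(** The iteration is an alternating direction method of multipliers (ADMM) for
    two blocks, [(phi, z)] and [q], in which the block [q] has no objective of
    its own.  Convergence for every [tau] in (0, 2), and not only below the
    golden ratio, rests on that fact, and the existence of a KKT point on the
    connectedness of the mesh.

    Splitting.  Put [p = (A phi, z)], [u = (q, B F q)], [y = (alpha, beta)] and
    [b = (0, d)] in one weighted Euclidean space.  The method alternates over
    [p] in a closed set [C] and [u] in a subspace [U], under the constraint
    [p - u = b].  Optimality of the [u]-step says that
    [y l + sigma (p l.+1 - u l.+1 - b)] is orthogonal to [U]; hence the
    component of [y l] along [U] is multiplied by [1 - tau] at every step
    ([multiplier_component_decay]).  For any saddle point [(ps, us, ys)] the
    quantity [|y l - ys|^2 / (2 tau sigma) + sigma / 2 |u l - us|^2] therefore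
    decreases by multiples of the squared residual and of the squared step
    [u l.+1 - u l], up to an error of order [(1 - tau)^(2 l)]
    ([energy_decrease]).  Adding the tail of that geometric series gives a
    genuine Lyapunov function, so the orbit is bounded and the residuals vanish;
    a cluster point is a saddle point, and the Lyapunov function of that very
    point tends to 0 along a subsequence, hence along the whole sequence
    ([splitting_converges]).  The variables [phi] and [q] are recovered by
    linear maps: [q] is a component of [u], and [A] is injective on the range
    of its adjoint ([linear_pinv]).

    Existence of a saddle point.  In terms of [phi] alone, the cone constraint
    at [(k, v)] reads [a + |D|^2 / 4 <= 0] with [a] and [D] linear in [phi],
    so that the program minimizes a linear form under convex quadratic
    constraints.  Multipliers come from the quadratic penalty method
    ([multipliers_exist]): minimizers of the penalized functions stay bounded,
    the multipliers that their stationarity defines are bounded by Slater's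
    condition, and a cluster point of both satisfies the KKT conditions.
    Slater's condition holds for the potential that decreases linearly in
    time.  Boundedness of the sublevel sets ([sublevel_bounded]) holds because
    the uniform density, which is strictly positive, can be completed by a
    flux into a solution of the discrete continuity equation
    ([uniform_flow_exists]): the two marginals have the same mass, and the
    kernel of the spatial gradient consists of the functions that are constant
    in space, because the mesh is connected ([mesh_const]).

    The cone.  The second-order cones are self-dual ([coneQ_dual]) and [T] is a
    bijection, since every coordinate of [z] occurs in exactly one block, with
    a positive factor; so the image of [Q] under the adjoint of [T] is the whole
    dual cone of the set of the [z] with [T z] in [Q] ([dual_cone_opT]), and the
    variational inequality of the saddle point yields the conic complementarity
    conditions. *)

(** * Families of reals: pointwise convergence and linear maps *)

Section Families.
Context {R : realType}.
Implicit Types I J K : finType.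

Lemma scale_famE (I : Type) (a : R) (x : I -> R) i : (a *: x) i = a * x i.
Proof. by []. Qed.

Definition tends {I} (u : nat -> I -> R) (x : I -> R) : Prop :=
  forall i, u n i @[n --> \oo] --> x i.

Lemma tends_ptws I (u : nat -> I -> R) x : tends u x -> {ptws, u @ \oo --> x}.
Proof.
move=> ux; apply/cvg_sup => i; apply/cvg_image.
  by apply/seteqP; split => // r _; exists (fun=> r).
move=> A /ux Ai.
by exists (fun y => A (y i)) => //; apply/seteqP; split => [r [y Ay <-//]|r Ar];
  exists (fun=> r).
Qed.

Lemma tends_cst I (x : I -> R) : tends (fun=> x) x.
Proof. by move=> i; exact: cvg_cst. Qed.
Arguments tends_cst {I} x.

Lemma tendsD I (u v : nat -> I -> R) x y :
  tends u x -> tends v y -> tends (fun n => u n + v n) (x + y).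
Proof. by move=> ux vy i; exact: cvgD. Qed.

Lemma tendsB I (u v : nat -> I -> R) x y :
  tends u x -> tends v y -> tends (fun n => u n - v n) (x - y).
Proof. by move=> ux vy i; apply: cvgB. Qed.

Lemma tendsZ I (a : R) (u : nat -> I -> R) x :
  tends u x -> tends (fun n => a *: u n) (a *: x).
Proof. by move=> ux i; apply: cvgM (ux i) => //; exact: cvg_cst. Qed.

Lemma tends_subseq I (u : nat -> I -> R) x (f : nat -> nat) :
  f @ \oo --> \oo -> tends u x -> tends (u \o f) x.
Proof. by move=> fo ux i; exact: (cvg_comp _ (fun n => u n i) fo (ux i)). Qed.

Lemma tends_fst I J (u : nat -> I + J -> R) x :
  tends u x -> tends (fun n => fst_part (u n)) (fst_part x).
Proof. by move=> ux i; exact: ux. Qed.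

Lemma tends_snd I J (u : nat -> I + J -> R) x :
  tends u x -> tends (fun n => snd_part (u n)) (snd_part x).
Proof. by move=> ux i; exact: ux. Qed.

Lemma tends_unique I (u : nat -> I -> R) x y : tends u x -> tends u y -> x = y.
Proof.
by move=> ux uy; apply/funext => i; rewrite -(cvg_lim _ (ux i))// -(cvg_lim _ (uy i)).
Qed.

Lemma cvg_sumr (T : Type) (F : set_system T) {FF : Filter F} I (f : I -> T -> R) (a : I -> R) :
  (forall i, f i t @[t --> F] --> a i) -> \sum_i f i t @[t --> F] --> \sum_i a i.
Proof. by move=> fa; apply: cvg_big => // -[x y]; exact: add_continuous. Qed.

Lemma cvg_dot I (u v : nat -> I -> R) x y : tends u x -> tends v y ->
  dot (u n) (v n) @[n --> \oo] --> dot x y.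
Proof. by move=> ux vy; apply: cvg_sumr => i; exact: cvgM. Qed.

Lemma dotC I (x y : I -> R) : dot x y = dot y x.
Proof. by apply: eq_bigr => i _; rewrite mulrC. Qed.

Lemma dotDl I (x y z : I -> R) : dot (x + y) z = dot x z + dot y z.
Proof. by rewrite -big_split; apply: eq_bigr => i _; rewrite mulrDl. Qed.

Lemma dotZl I (a : R) (x z : I -> R) : dot (a *: x) z = a * dot x z.
Proof. by rewrite mulr_sumr; apply: eq_bigr => i _; rewrite -mulrA. Qed.

Lemma dotNl I (x z : I -> R) : dot (- x) z = - dot x z.
Proof. by rewrite -scaleN1r dotZl mulN1r. Qed.

Lemma dotBl I (x y z : I -> R) : dot (x - y) z = dot x z - dot y z.
Proof. by rewrite dotDl dotNl. Qed.

Lemma dotDr I (x y z : I -> R) : dot z (x + y) = dot z x + dot z y.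
Proof. by rewrite dotC dotDl !(dotC _ z). Qed.

Lemma dotZr I (a : R) (x z : I -> R) : dot z (a *: x) = a * dot z x.
Proof. by rewrite dotC dotZl dotC. Qed.

Lemma dotNr I (x z : I -> R) : dot z (- x) = - dot z x.
Proof. by rewrite dotC dotNl dotC. Qed.

Lemma dotBr I (x y z : I -> R) : dot z (x - y) = dot z x - dot z y.
Proof. by rewrite dotC dotBl !(dotC _ z). Qed.

Lemma dot0l I (x : I -> R) : dot 0 x = 0.
Proof. by rewrite /dot big1 // => i _; rewrite mul0r. Qed.

Lemma dot0r I (x : I -> R) : dot x 0 = 0.
Proof. by rewrite dotC dot0l. Qed.

Lemma dot_ge0 I (x : I -> R) : 0 <= dot x x.
Proof. by apply: sumr_ge0 => i _; rewrite -expr2 sqr_ge0. Qed.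

Lemma sqr_le_dot I (x : I -> R) i : x i ^+ 2 <= dot x x.
Proof.
rewrite /dot (bigD1 i) //= -expr2 lerDl.
by apply: sumr_ge0 => j _; rewrite -expr2 sqr_ge0.
Qed.

Lemma dot_eq0 I (x : I -> R) : dot x x = 0 -> x = 0.
Proof.
move=> x0; apply/funext => i; apply/eqP; rewrite -(sqrf_eq0 (x i)) eq_le sqr_ge0 andbT.
by rewrite -x0 sqr_le_dot.
Qed.

Lemma dot_unit_vec I (x : I -> R) i : dot (unit_vec i) x = x i.
Proof.
rewrite /dot (bigD1 i) //= /unit_vec eqxx mul1r big1 ?addr0// => j ji.
by rewrite (negbTE ji) mul0r.
Qed.

Lemma dot_ext I (x y : I -> R) : (forall z, dot z x = dot z y) -> x = y.
Proof. by move=> h; apply/funext => i; rewrite -dot_unit_vec h dot_unit_vec. Qed.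

Lemma dot_stack I J (x x' : I -> R) (y y' : J -> R) :
  dot (stack x y) (stack x' y') = dot x x' + dot y y'.
Proof. by rewrite /dot big_sumType. Qed.

Lemma stack_parts I J (x : I + J -> R) : stack (fst_part x) (snd_part x) = x.
Proof. by apply/funext => -[]. Qed.

Lemma sqr_dot_le I (x y : I -> R) : dot x y ^+ 2 <= dot x x * dot y y.
Proof.
have := dot_ge0 (dot y y *: x - dot x y *: y).
rewrite dotBl !dotBr !dotZl !dotZr (dotC y x) => h.
have [y0|y0] := eqVneq (dot y y) 0.
  by rewrite (dot_eq0 y0) !dot0r expr0n mulr0.
have yy : 0 < dot y y by rewrite lt_def y0 dot_ge0.
have : 0 <= dot y y * (dot x x * dot y y - dot x y ^+ 2) by apply: (le_trans h); lra.
by rewrite pmulr_rge0// subr_ge0.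
Qed.

Lemma normr_dot_le I (x y : I -> R) : `|dot x y| <= enorm x * enorm y.
Proof. by rewrite -sqrtr_sqr -sqrtrM ?dot_ge0// ler_wsqrtr// sqr_dot_le. Qed.

(** Every coordinate of a linear map is a dot product with a fixed family,
    hence continuous and bounded on bounded sets. *)
Lemma linear_coordE I J (L : (I -> R) -> (J -> R)) x j : linear L ->
  L x j = dot x (adj L (unit_vec j)).
Proof. by move=> linL; rewrite -adjP// dotC dot_unit_vec. Qed.

Lemma tends_linear I J (L : (I -> R) -> (J -> R)) u x : linear L ->
  tends u x -> tends (fun n => L (u n)) (L x).
Proof.
move=> linL ux j; rewrite (linear_coordE x j linL).
rewrite (_ : (fun n => L (u n) j) = fun n => dot (u n) (adj L (unit_vec j))).
  exact: (cvg_dot ux (tends_cst _)).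
by apply/funext => n; exact: linear_coordE.
Qed.

Lemma cvgn_mono_infty (f : nat -> nat) : {mono f : n m / (n <= m)%N} -> f @ \oo --> \oo.
Proof.
move=> fm; have fge n : (n <= f n)%N.
  by elim: n => // n IH; rewrite (leq_ltn_trans IH)// ltnNge fm -ltnNge.
apply/cvgnyPge => A; near=> n; apply: (leq_trans _ (fge n)); near: n.
exact: nbhs_infty_ge.
Unshelve. all: by end_near. Qed.

Lemma bounded_subseq I (u : nat -> I -> R) (K : R) : (forall n i, `|u n i| <= K) ->
  exists f : nat -> nat, f @ \oo --> \oo /\ exists x, tends (u \o f) x.
Proof.
move=> uK.
suff [f [fo fx]] : exists f : nat -> nat, f @ \oo --> \oo /\
    forall i, i \in enum I -> cvg (u (f n) i @[n --> \oo]).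
  exists f; split => //; exists (fun i => lim (u (f n) i @[n --> \oo])) => i.
  by apply: fx; rewrite mem_enum.
elim: (enum I) => [|i s [f [fo fs]]]; first by exists id; split.
have [|g gm gx] := @bolzano_weierstrass R (fun n => u (f n) i).
  exists K; split; first exact: num_real.
  by move=> x Kx n _ /=; apply: le_trans (ltW Kx).
have go := cvgn_mono_infty gm.
exists (f \o g); split; first exact: cvg_comp go fo.
move=> j; rewrite inE => /predU1P[->//|js]; apply/cvg_ex.
have /cvg_ex[l jl] := fs _ js.
by exists l; exact: cvg_comp go jl.
Qed.

Lemma linear_famB I J (L : (I -> R) -> (J -> R)) x y : linear L -> L (x - y) = L x - L y.
Proof. by move=> linL; rewrite addrC -scaleN1r linL scaleN1r addrC. Qed.

Lemma linear_fam0 I J (L : (I -> R) -> (J -> R)) : linear L -> L 0 = 0.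
Proof. by move=> linL; rewrite -(subrr 0) linear_famB// subrr. Qed.

Lemma linear_famZ I J (L : (I -> R) -> (J -> R)) a x : linear L -> L (a *: x) = a *: L x.
Proof. by move=> linL; rewrite -[a *: x]addr0 linL linear_fam0// addr0. Qed.

Lemma linear_famD I J (L : (I -> R) -> (J -> R)) x y : linear L -> L (x + y) = L x + L y.
Proof. by move=> linL; rewrite -[x]scale1r linL !scale1r. Qed.

Lemma linear_adj I J (L : (I -> R) -> (J -> R)) : linear (adj L).
Proof. by move=> a x y; apply/funext => i; rewrite /adj dotDr dotZr. Qed.

(** First-order optimality: a function of the form [t * a + O(t^2)] that is
    nonnegative for small positive [t] has a nonnegative slope [a]. *)
Lemma linear_ineq_slope (a C : R) : (forall t, 0 < t <= 1 -> 0 <= t * a + t ^+ 2 * C) -> 0 <= a.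
Proof.
move=> h; rewrite leNgt; apply/negP => a0.
(* The value of [t] makes [t * (- a + |C| + 1)] equal to [- a], so that the
   quadratic term cannot compensate the negative slope. *)
pose t := - a / (- a + `|C| + 1).
have d0 : 0 < - a + `|C| + 1 by have := normr_ge0 C; lra.
have t0 : 0 < t by rewrite divr_gt0// oppr_gt0.
have t1 : t <= 1 by rewrite ler_pdivrMr// mul1r; have := normr_ge0 C; lra.
have := h t; rewrite t0 t1 => /(_ isT).
rewrite expr2 -mulrA -mulrDr pmulr_rge0// => ht.
have : t * (- a + `|C| + 1) = - a by rewrite /t mulfVK// gt_eqF.
have : t * C <= t * `|C| by rewrite ler_pM2l// ler_norm.
have : 0 < t * (- a + 1) by rewrite mulr_gt0//; lra.
lra.
Qed.

End Families.
Arguments tends_cst {R I} x.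
Arguments tendsZ {R I} a {u x} _ _.

(** * A generalized inverse *)

Lemma row_mul_tr_eq0 (R : realType) n (v : 'rV[R]_n) : v *m v^T = 0 -> v = 0.
Proof.
move=> vv; apply/rowP => i; rewrite [RHS]mxE; apply/eqP; rewrite -sqrf_eq0.
have /matrixP/(_ 0 0) := vv; rewrite !mxE => /eqP.
rewrite psumr_eq0 => [/allP/(_ i)|j _]; last by rewrite !mxE -expr2 sqr_ge0.
by rewrite mem_index_enum => /(_ isT); rewrite !mxE -expr2.
Qed.

Section Pseudo_inverse.
Context {R : realType} {I J : finType}.

(** Over the reals the Gram matrix [a^T a] has the same row space as
    [a], because a row that is both of the form [u a^T] and killed by [a] has
    norm 0.  A generalized inverse of [a^T a] followed by the adjoint therefore
    inverts [L] on its range, with values in the range of the adjoint. *)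
Lemma linear_pinv (L : (I -> R) -> (J -> R)) : linear L ->
  exists P : (J -> R) -> (I -> R), [/\ linear P,
    forall x, L (P (L x)) = L x & forall y, range (adj L) (P y)].
Proof.
move=> linL.
(* Families are coded as row vectors; linear maps then act on the right,
   and [a] is the matrix of [L]. *)
pose rowI (x : I -> R) := \row_(k < #|I|) x (enum_val k).
pose rowJ (y : J -> R) := \row_(k < #|J|) y (enum_val k).
pose famJ (v : 'rV[R]_#|J|) (j : J) := v 0 (enum_rank j).
have rowJK y : famJ (rowJ y) = y.
  by apply/funext => j; rewrite /famJ mxE enum_rankK.
have famJK v : rowJ (famJ v) = v.
  by apply/rowP => j; rewrite mxE /famJ enum_valK.
pose a := \matrix_(i < #|I|, j < #|J|) L (unit_vec (enum_val i)) (enum_val j).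
have rowL x : rowJ (L x) = rowI x *m a.
  apply/rowP => j; rewrite !mxE linear_coordE// /dot (reindex_onto enum_val enum_rank) /=.
    apply: eq_big => [i|i _]; first by rewrite enum_valK eqxx.
    by rewrite !mxE /adj dotC dot_unit_vec.
  by move=> i _; rewrite enum_rankK.
have rowadj y : rowI (adj L y) = rowJ y *m a^T.
  apply/rowP => i; rewrite !mxE /adj dotC /dot (reindex_onto enum_val enum_rank) /=.
    apply: eq_big => [j|j _]; first by rewrite enum_valK eqxx.
    by rewrite !mxE.
  by move=> j _; rewrite enum_rankK.
have sub_gram : (a <= a^T *m a)%MS.
  have /mxrank_leqif_sup[le_rank <-] := submxMl a^T a.
  have cap0 : \rank (a^T :&: kermx a)%MS = 0%N.
    apply/eqP; rewrite mxrank_eq0 -submx0; apply/rV_subP => v.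
    rewrite sub_capmx => /andP[/submxP[u vE] /sub_kermxP va0]; rewrite submx0.
    by rewrite (row_mul_tr_eq0 (v := v))// [in v^T]vE trmx_mul trmxK mulmxA va0 mul0mx.
  have := mxrank_mul_ker a^T a; rewrite cap0 addn0 mxrank_tr => ->.
  by rewrite eqxx.
pose pre (y : J -> R) := famJ (rowJ y *m pinvmx (a^T *m a)).
have lin_pre : linear pre.
  move=> r x y; apply/funext => j; rewrite /pre /famJ.
  have -> : rowJ (r *: x + y) = r *: rowJ x + rowJ y.
    by apply/rowP => k; rewrite !mxE.
  by rewrite mulmxDl -scalemxAl mxE mxE.
exists (fun y => adj L (pre y)); split.
- by move=> r x y /=; rewrite lin_pre; exact: linear_adj.
- move=> x; rewrite -[LHS]rowJK -[RHS]rowJK; congr famJ.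
  rewrite rowL rowadj /pre famJK rowL -(mulmxA _ a^T a) mulmxKpV//.
  exact: (submx_trans (submxMl _ _)).
- by move=> y; exists (pre y).
Qed.

End Pseudo_inverse.

(** * Weighted dot products *)

Section Weighted.
Context {R : realType} {K : finType} (w : K -> R).
Hypothesis w_gt0 : forall k, 0 < w k.
Implicit Types x y z : K -> R.

Definition weigh x : K -> R := fun k => w k * x k.
Definition wdot x y : R := dot x (weigh y).

Lemma weighD x y : weigh (x + y) = weigh x + weigh y.
Proof. by apply/funext => k; rewrite /weigh mulrDr. Qed.
Lemma weighZ a x : weigh (a *: x) = a *: weigh x.
Proof. by apply/funext => k; rewrite /weigh !scale_famE mulrCA. Qed.

Lemma wdotC x y : wdot x y = wdot y x.
Proof. by apply: eq_bigr => k _; rewrite /weigh mulrCA [RHS]mulrCA (mulrC (x k)). Qed.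
Lemma wdotDl x y z : wdot (x + y) z = wdot x z + wdot y z.
Proof. exact: dotDl. Qed.
Lemma wdotZl a x z : wdot (a *: x) z = a * wdot x z.
Proof. exact: dotZl. Qed.
Lemma wdotNl x z : wdot (- x) z = - wdot x z.
Proof. exact: dotNl. Qed.
Lemma wdotBl x y z : wdot (x - y) z = wdot x z - wdot y z.
Proof. exact: dotBl. Qed.
Lemma wdotDr x y z : wdot z (x + y) = wdot z x + wdot z y.
Proof. by rewrite /wdot weighD dotDr. Qed.
Lemma wdotZr a x z : wdot z (a *: x) = a * wdot z x.
Proof. by rewrite /wdot weighZ dotZr. Qed.
Lemma wdotNr x z : wdot z (- x) = - wdot z x.
Proof. by rewrite wdotC wdotNl wdotC. Qed.
Lemma wdotBr x y z : wdot z (x - y) = wdot z x - wdot z y.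
Proof. by rewrite wdotDr wdotNr. Qed.

Lemma cvg_wdot (u v : nat -> K -> R) x y : tends u x -> tends v y ->
  wdot (u n) (v n) @[n --> \oo] --> wdot x y.
Proof. by move=> ux vy; apply: cvg_dot => // k; apply: cvgM (vy k) => //; exact: cvg_cst. Qed.

Lemma wdotE x : wdot x x = \sum_k w k * x k ^+ 2.
Proof. by apply: eq_bigr => k _; rewrite /weigh mulrCA expr2. Qed.

Lemma wdot_ge0 x : 0 <= wdot x x.
Proof. by rewrite wdotE sumr_ge0// => k _; rewrite mulr_ge0 ?sqr_ge0 ?ltW. Qed.

Lemma wsqr_le_wdot x k : w k * x k ^+ 2 <= wdot x x.
Proof.
rewrite wdotE (bigD1 k) //= lerDl.
by rewrite sumr_ge0// => j _; rewrite mulr_ge0 ?sqr_ge0 ?ltW.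
Qed.

Lemma coord_le_wdot x k (B : R) : wdot x x <= B -> `|x k| <= Num.sqrt (B / w k).
Proof.
move=> xB; rewrite -sqrtr_sqr ler_wsqrtr// ler_pdivlMr// mulrC.
exact: le_trans (wsqr_le_wdot x k) xB.
Qed.

Lemma coord_bounded (B : R) :
  exists C, forall x, wdot x x <= B -> forall k, `|x k| <= C.
Proof.
exists (\sum_k Num.sqrt (B / w k)) => x xB k; rewrite (bigD1 k) //=.
apply: le_trans (coord_le_wdot k xB) _.
by rewrite lerDl sumr_ge0// => j _; exact: sqrtr_ge0.
Qed.

Lemma tends_wdot0 (u : nat -> K -> R) :
  wdot (u n) (u n) @[n --> \oo] --> 0 -> tends u 0.
Proof.
move=> u0 k; apply/cvgr0Pnorm_lt => e e0.
have : 0 < w k * e ^+ 2 by rewrite mulr_gt0// exprn_gt0.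
move/cvgr0Pnorm_lt : u0 => /[apply]; apply: filterS => n /(le_lt_trans (ler_norm _)).
move/(le_lt_trans (wsqr_le_wdot _ k)); rewrite ltr_pM2l// => h.
by rewrite -(@ltr_pXn2r _ 2)// ?nnegrE ?normr_ge0 ?(ltW e0)// real_normK ?num_real.
Qed.

Lemma tends_wdotB (u : nat -> K -> R) x :
  wdot (u n - x) (u n - x) @[n --> \oo] --> 0 -> tends u x.
Proof.
move=> /tends_wdot0 h k; apply: (@cvg_sub0 _ _ _ _ _ (fun n => u n k) (fun=> x k)).
  exact: h k.
exact: cvg_cst.
Qed.

End Weighted.

Arguments cvg_wdot {R K} w {u v x y} _ _.

(** * The alternating method for two blocks *)

Section Splitting.
Context {R : realType} {K : finType} (w : K -> R).
Hypothesis w_gt0 : forall k, 0 < w k.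
Context (C U : set (K -> R)) (s b : K -> R).
Hypothesis U_lin : forall a x y, U x -> U y -> U (a *: x + y).
Hypothesis closedC : forall x v, (forall n, C (x n)) -> tends x v -> C v.
Hypothesis closedU : forall x v, (forall n, U (x n)) -> tends x v -> U v.
Local Notation "<| x , y |>" := (wdot w x y).

(** Saddle points of the Lagrangian of: minimize [<s, p>] over [p] in [C] and
    [u] in [U] subject to [p - u = b], where [y] is the multiplier.  Only the
    block [p] has an objective, so [y] is orthogonal to [U]. *)
Record saddle (p u y : K -> R) : Prop := Saddle {
  saddle_C : C p;
  saddle_U : U u;
  saddle_eq : p - u = b;
  saddle_orth : forall v, U v -> <|v, y|> = 0;
  saddle_min : forall p', C p' -> 0 <= <|p' - p, s + y|>
}.

Context (sigma tau : R) (p u y : nat -> K -> R).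
Hypothesis sigma_gt0 : 0 < sigma.
Hypothesis tau_bounds : 0 < tau < 2.
Hypothesis p_in : forall l, C (p l.+1).
Hypothesis u_in : forall l, U (u l).
Hypothesis p_step : forall l p', C p' ->
  0 <= <|p' - p l.+1, s + (y l + sigma *: (p l.+1 - u l - b))|>.
Hypothesis u_step : forall l v, U v ->
  <|v, y l + sigma *: (p l.+1 - u l.+1 - b)|> = 0.
Hypothesis y_step : forall l,
  y l.+1 = y l + (tau * sigma) *: (p l.+1 - u l.+1 - b).

Let U_sub x z : U x -> U z -> U (x - z).
Proof. by move=> Ux Uz; rewrite -scaleN1r addrC; exact: U_lin. Qed.

Let tau_gt0 : 0 < tau. Proof. by case/andP: tau_bounds. Qed.
Let tau_lt2 : tau < 2. Proof. by case/andP: tau_bounds. Qed.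
Let kappa := (2 * tau * sigma)^-1.
Let tau_half : 0 < 1 - tau / 2. Proof. by have := tau_lt2; lra. Qed.
Let kappa_gt0 : 0 < kappa. Proof. by rewrite invr_gt0 !mulr_gt0. Qed.

(** The algebra of one step.  Here [r] is the new residual, [d] the step of
    [u], [v] the new error of [u] and [e] the old error of the multiplier.  The
    first two assumptions are the variational inequalities of the [p]-step and
    of the saddle point, tested against each other; the last one
    says that along [d] the multiplier is [t] times the initial one, and the
    others express orthogonality to [U].  The cross term [<r, d>] is not
    controlled by monotonicity: orthogonality turns it into a product of [d]
    with the multiplier, which Young's inequality absorbs. *)
Lemma energy_algebra (r d v e ys y0 : K -> R) (t : R) :
  0 <= <|- (r + v), s + (e + ys + sigma *: (r + d))|> ->
  0 <= <|r + v, s + ys|> ->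
  <|v, e + ys + sigma *: r|> = 0 -> <|v, ys|> = 0 ->
  <|d, e + ys + sigma *: r|> = 0 -> <|d, e + ys|> = t * <|d, y0|> ->
  kappa * <|e + (tau * sigma) *: r, e + (tau * sigma) *: r|> + sigma / 2 * <|v, v|> <=
  kappa * <|e, e|> + sigma / 2 * <|v - d, v - d|> - sigma * (1 - tau / 2) * <|r, r|>
    - sigma / 4 * <|d, d|> + t ^+ 2 * (<|y0, y0|> / sigma).
Proof.
move=> h1 h2 h3 h4 h5 h6.
have h7 : 0 <= sigma / 4 * <|d, d|> - t * <|d, y0|> + t ^+ 2 * (<|y0, y0|> / sigma).
  have := wdot_ge0 w_gt0 ((sigma / 2) *: d - t *: y0).
  rewrite -(pmulr_rge0 _ (_ : 0 < sigma^-1)) ?invr_gt0//.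
  rewrite !(wdotBl, wdotBr, wdotZl, wdotZr) (wdotC w y0 d).
  congr (0 <= _); field; exact: lt0r_neq0.
have kE : kappa * <|e + (tau * sigma) *: r, e + (tau * sigma) *: r|> =
    kappa * <|e, e|> + <|r, e|> + tau * sigma / 2 * <|r, r|>.
  rewrite !(wdotDl, wdotDr, wdotZl, wdotZr) (wdotC w e) /kappa; field.
  by rewrite !lt0r_neq0.
rewrite kE; move: h1 h2 h3 h4 h5 h6 h7.
rewrite !(wdotDl, wdotDr, wdotBl, wdotBr, wdotNl, wdotNr, wdotZl, wdotZr).
rewrite (wdotC w d v) (wdotC w d r).
lra.
Qed.

Let r l := p l.+1 - u l.+1 - b.
Let D l := u l.+1 - u l.
Let theta := 1 - tau.

(** This is where the absence of an objective in the block [u] is used: the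
    multiplier step is [tau] times the step that would make [y] orthogonal to
    [U]. *)
Lemma multiplier_component_decay l v : U v -> <|v, y l|> = theta ^+ l * <|v, y 0%N|>.
Proof.
move=> Uv; elim: l => [|l IH]; first by rewrite mul1r.
have := u_step l Uv; rewrite -/(r l) wdotDr wdotZr IH => h.
rewrite y_step -/(r l) wdotDr wdotZr IH exprS.
have -> : tau * sigma * <|v, r l|> = tau * (sigma * <|v, r l|>) by rewrite mulrA.
have -> : sigma * <|v, r l|> = - (theta ^+ l * <|v, y 0%N|>) by lra.
rewrite /theta; ring.
Qed.

(** The weighted distance to a saddle point in which the iteration is monotone
    up to a summable error. *)
Definition energy us ys l :=
  kappa * <|y l - ys, y l - ys|> + sigma / 2 * <|u l - us, u l - us|>.

Lemma energy_decrease ps us ys l : saddle ps us ys ->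
  energy us ys l.+1 <= energy us ys l - sigma * (1 - tau / 2) * <|r l, r l|>
    - sigma / 4 * <|D l, D l|> + (theta ^+ 2) ^+ l * (<|y 0%N, y 0%N|> / sigma).
Proof.
case=> Cps Uus eqs orths mins.
have Ul : U (u l.+1 - us) by exact: U_sub.
have DU : U (D l) by exact: U_sub.
have h1 := p_step l Cps; have h2 := mins _ (p_in l).
have h3 := u_step l Ul; have h4 := orths _ Ul.
have h5 := u_step l DU; have h6 := multiplier_component_decay l DU.
rewrite /energy y_step -/(r l).
pose e := y l - ys; pose V := u l.+1 - us.
have pE : p l.+1 - ps = r l + V.
  by rewrite /r /V -eqs; apply/funext => k; rewrite !fctE; ring.
have uE : u l - us = V - D l.
  by rewrite /V /D; apply/funext => k; rewrite !fctE; ring.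
have qE : p l.+1 - u l - b = r l + D l.
  by rewrite /r /D; apply/funext => k; rewrite !fctE; ring.
have yE : y l = e + ys by rewrite subrK.
have yE' : y l + (tau * sigma) *: r l - ys = e + (tau * sigma) *: r l.
  by rewrite /e addrAC.
rewrite yE' uE exprAC; apply: (@energy_algebra (r l) (D l) V e ys).
- by rewrite -pE opprB -qE -yE.
- by rewrite -pE.
- by rewrite -yE.
- exact: h4.
- by rewrite -yE.
- by rewrite -yE.
Qed.

Let theta2_ge0 : 0 <= theta ^+ 2. Proof. exact: sqr_ge0. Qed.
Let theta2_lt1 : theta ^+ 2 < 1.
Proof.
have -> : theta ^+ 2 = 1 - tau * (2 - tau) by rewrite /theta; ring.
by have : 0 < tau * (2 - tau) by [rewrite mulr_gt0// subr_gt0]; lra.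
Qed.

(** The second term is the sum over all later steps of the errors in
    [energy_decrease]. *)
Definition lyapunov us ys l := energy us ys l
  + (theta ^+ 2) ^+ l * (<|y 0%N, y 0%N|> / sigma / (1 - theta ^+ 2)).

Lemma lyapunov_decrease ps us ys l : saddle ps us ys ->
  lyapunov us ys l.+1 <= lyapunov us ys l - sigma * (1 - tau / 2) * <|r l, r l|>
    - sigma / 4 * <|D l, D l|>.
Proof.
move=> S; have := energy_decrease l S; rewrite /lyapunov (exprS (theta ^+ 2) l).
set q := theta ^+ 2; set B := _ / sigma => h.
have -> : q * q ^+ l * (B / (1 - q)) = q ^+ l * (B / (1 - q)) - q ^+ l * B.
  by field; rewrite gt_eqF// subr_gt0.
lra.
Qed.

Let rD_ge0 l : 0 <= sigma * (1 - tau / 2) * <|r l, r l|> /\ 0 <= sigma / 4 * <|D l, D l|>.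
Proof.
split; apply: mulr_ge0; rewrite ?wdot_ge0//; last by rewrite divr_ge0// ltW.
by rewrite mulr_ge0// ltW.
Qed.

Lemma energy_terms_ge0 us ys l : 0 <= kappa * <|y l - ys, y l - ys|> /\
  0 <= sigma / 2 * <|u l - us, u l - us|>.
Proof.
by split; apply: mulr_ge0; rewrite ?wdot_ge0// ltW// divr_gt0.
Qed.

Lemma energy_le_lyapunov us ys l : energy us ys l <= lyapunov us ys l.
Proof.
rewrite /lyapunov lerDl; apply: mulr_ge0; first exact: exprn_ge0.
apply: divr_ge0; first by rewrite divr_ge0 ?wdot_ge0// ltW.
by rewrite subr_ge0 ltW.
Qed.

Lemma lyapunov_noninc ps us ys : saddle ps us ys ->
  {homo lyapunov us ys : m n / (m <= n)%N >-> n <= m}.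
Proof.
move=> S; apply/nonincreasing_seqP => l.
by have := lyapunov_decrease l S; have [] := rD_ge0 l; lra.
Qed.

Lemma lyapunov_ge0 us ys l : 0 <= lyapunov us ys l.
Proof.
apply: le_trans (energy_le_lyapunov us ys l); have [] := energy_terms_ge0 us ys l.
exact: addr_ge0.
Qed.

Lemma residuals_to0 ps us ys : saddle ps us ys -> tends r 0 /\ tends D 0.
Proof.
move=> S.
have Lcvg : cvgn (lyapunov us ys).
  apply: nonincreasing_is_cvgn; first exact: lyapunov_noninc S.
  by exists 0 => _ [l _ <-]; exact: lyapunov_ge0.
pose d l := lyapunov us ys l - lyapunov us ys l.+1.
have d0 : d @ \oo --> 0.
  rewrite -(subrr (limn (lyapunov us ys))); apply: cvgB => //.
  by rewrite (cvg_shiftS (lyapunov us ys)).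
have dle l : sigma * (1 - tau / 2) * <|r l, r l|> + sigma / 4 * <|D l, D l|> <= d l.
  by have := lyapunov_decrease l S; rewrite /d; lra.
have aux (c : R) (f : nat -> R) : 0 < c -> (forall l, 0 <= f l) ->
    (forall l, c * f l <= d l) -> f @ \oo --> 0.
  move=> c0 f0 fd; apply: (@squeeze_cvgr _ _ _ _ (fun=> 0) (fun l => c^-1 * d l)).
  - by apply: nearW => l; rewrite /= f0 /= ler_pdivlMl ?fd.
  - exact: cvg_cst.
  - by rewrite -(mulr0 c^-1); apply: cvgM => //; exact: cvg_cst.
split; apply: (tends_wdot0 w_gt0).
- apply: (aux (sigma * (1 - tau / 2))) => [|l|l]; first by rewrite mulr_gt0.
    exact: wdot_ge0.
  by have := dle l; have [] := rD_ge0 l; lra.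
- apply: (aux (sigma / 4)) => [|l|l]; first by rewrite divr_gt0.
    exact: wdot_ge0.
  by have := dle l; have [] := rD_ge0 l; lra.
Qed.

Lemma orbit_bounded ps us ys : saddle ps us ys ->
  exists B, forall l k, `|stack (u l) (y l) k| <= B.
Proof.
move=> S; set E := lyapunov us ys 0.
have le_E l : energy us ys l <= E.
  by apply: le_trans (energy_le_lyapunov us ys l) _; exact: (lyapunov_noninc S).
have [B1 B1P] := coord_bounded w_gt0 (E / (sigma / 2)).
have [B2 B2P] := coord_bounded w_gt0 (E / kappa).
exists (`|B1| + `|B2| + \sum_k `|us k| + \sum_k `|ys k|) => l.
have le_sum (x : K -> R) k : `|x k| <= \sum_k `|x k|.
  by rewrite (bigD1 k)//= lerDl sumr_ge0.
have split_le (x x' : K -> R) k : `|x k| <= `|(x - x') k| + \sum_k `|x' k|.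
  apply: le_trans (lerD (lexx _) (le_sum x' k)).
  by apply: le_trans (ler_normD _ _); rewrite !fctE subrK.
have u_sum : 0 <= \sum_k `|us k| by exact: sumr_ge0.
have y_sum : 0 <= \sum_k `|ys k| by exact: sumr_ge0.
have [ge_y ge_u] := energy_terms_ge0 us ys l; have := le_E l; rewrite /energy => leE.
case=> k /=; [have := split_le (u l) us k|have := split_le (y l) ys k] => h.
  have : `|(u l - us) k| <= B1 by apply: B1P; rewrite ler_pdivlMr ?divr_gt0// mulrC; lra.
  by have := ler_norm B1; have := normr_ge0 B2; lra.
have : `|(y l - ys) k| <= B2 by apply: B2P; rewrite ler_pdivlMr// mulrC; lra.
by have := ler_norm B2; have := normr_ge0 B1; lra.
Qed.

Lemma theta_to0 : theta ^+ l @[l --> \oo] --> 0.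
Proof.
apply: cvg_expr; rewrite -(@ltr_pXn2r _ 2)// ?nnegrE// expr1n.
by rewrite real_normK ?num_real.
Qed.

(** Since the residuals and the steps vanish, [y l], [u l] and their successors
    have the same limits along the subsequence, and the variational
    inequalities pass to the limit. *)
Lemma cluster_saddle (f : nat -> nat) us ys ps0 us0 ys0 : saddle ps0 us0 ys0 ->
  f @ \oo --> \oo -> tends (u \o S \o f) us -> tends (y \o S \o f) ys ->
  saddle (us + b) us ys.
Proof.
move=> Sad0 fo fu fy; have [r0 D0] := residuals_to0 Sad0.
have fr := tends_subseq fo r0; have fD := tends_subseq fo D0.
have fp : tends (p \o S \o f) (us + b).
  have := tendsD fr (tendsD fu (tends_cst b)); rewrite add0r.
  by congr (tends _ _); apply/funext => n; apply/funext => k; rewrite /r !fctE/=; ring.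
have fy0 : tends (y \o f) ys.
  have := tendsB fy (tendsZ (tau * sigma) fr); rewrite scaler0 subr0.
  by congr (tends _ _); apply/funext => n /=; rewrite y_step addrK.
have fq : tends (fun n => p (f n).+1 - u (f n) - b) 0.
  have := tendsD fr fD; rewrite addr0.
  by congr (tends _ _); apply/funext => n; apply/funext => k; rewrite /r /D !fctE/=; ring.
split.
- by apply: closedC fp => n; exact: p_in.
- by apply: closedU fu => n; exact: u_in.
- by rewrite addrAC subrr add0r.
- move=> v Uv; have /cvg_lim <-// := cvg_wdot w (tends_cst v) fy0.
  apply/cvg_lim => //; rewrite (_ : (fun n => _) = fun n => theta ^+ f n * <|v, y 0%N|>).
    rewrite -(mul0r <|v, y 0%N|>); apply: cvgM; last exact: cvg_cst.
    exact: (cvg_comp _ _ fo theta_to0).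
  by apply/funext => n; exact: multiplier_component_decay.
- move=> p' Cp'.
  have h := cvg_wdot w (tendsB (tends_cst p') fp)
    (tendsD (tends_cst s) (tendsD fy0 (tendsZ sigma fq))).
  have -> : s + ys = s + (ys + sigma *: 0) by rewrite scaler0 addr0.
  by apply: (cvgr_to_ge h); apply: nearW => n; exact: p_step.
Qed.

Lemma noninc_cvg0_subseq (g : nat -> R) (f : nat -> nat) :
  {homo g : m n / (m <= n)%N >-> n <= m} -> (forall n, 0 <= g n) ->
  g (f n) @[n --> \oo] --> 0 -> g @ \oo --> 0.
Proof.
move=> gm g0 /cvgr0Pnorm_lt gf; apply/cvgr0Pnorm_lt => e /gf.
case=> n _ /(_ n (leqnn n)) /=; rewrite ger0_norm// => gn.
by exists (f n) => // m /= fm; rewrite ger0_norm// (le_lt_trans (gm _ _ fm)).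
Qed.

(** Once a cluster point is known to be a saddle point, the Lyapunov function
    may be centered at it: it is nonincreasing and tends to 0 along a
    subsequence, so it tends to 0. *)
Theorem splitting_converges : (exists ps us ys, saddle ps us ys) ->
  exists ps us ys, [/\ saddle ps us ys, tends (p \o S) ps, tends u us & tends y ys].
Proof.
move=> [ps0 [us0 [ys0 S0]]]; have [B bnd] := orbit_bounded S0.
have [f [fo [x fx]]] := bounded_subseq (fun n k => bnd n.+1 k).
pose us := fst_part x; pose ys := snd_part x.
have fu : tends (u \o S \o f) us by move=> k; exact: fx (inl k).
have fy : tends (y \o S \o f) ys by move=> k; exact: fx (inr k).
have Sad := cluster_saddle S0 fo fu fy.
have L0 : lyapunov us ys @ \oo --> 0.
  apply: (@noninc_cvg0_subseq _ (S \o f)) (lyapunov_noninc Sad) (lyapunov_ge0 us ys) _.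
  have sq0 (v : nat -> K -> R) vs : tends v vs -> <|v n - vs, v n - vs|> @[n --> \oo] --> 0.
    move=> h; have h' := tendsB h (tends_cst vs).
    by have := cvg_wdot w h' h'; rewrite subrr /wdot dot0l.
  have -> : (0 : R) = kappa * 0 + sigma / 2 * 0
      + 0 * (<|y 0%N, y 0%N|> / sigma / (1 - theta ^+ 2)).
    by rewrite !mulr0 mul0r !addr0.
  apply: cvgD; [apply: cvgD|]; apply: cvgM; try exact: cvg_cst.
  - exact: (sq0 _ _ fy).
  - exact: (sq0 _ _ fu).
  - apply: (cvg_comp (S \o f) (fun l => (theta ^+ 2) ^+ l)).
      apply: (cvg_comp f S fo); exact: (cvg_addnl 1%N).
    by apply: cvg_expr; rewrite ger0_norm.
have aux (c : R) (v : nat -> K -> R) vs : 0 < c ->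
    (forall l, c * <|v l - vs, v l - vs|> <= lyapunov us ys l) -> tends v vs.
  move=> c0 h; apply: (tends_wdotB w_gt0).
  apply: (@squeeze_cvgr _ _ _ _ (fun=> 0) (fun l => c^-1 * lyapunov us ys l)).
  - by apply: nearW => l; rewrite /= wdot_ge0//= ler_pdivlMl ?h.
  - exact: cvg_cst.
  - by rewrite -(mulr0 c^-1); apply: cvgM => //; exact: cvg_cst.
have ten_u : tends u us.
  apply: (aux (sigma / 2)) => [|l]; first by rewrite divr_gt0.
  apply: le_trans (energy_le_lyapunov us ys l).
  by have [] := energy_terms_ge0 us ys l; rewrite lerDr.
have ten_y : tends y ys.
  apply: (aux kappa) => // l.
  apply: le_trans (energy_le_lyapunov us ys l).
  by have [] := energy_terms_ge0 us ys l; rewrite lerDl.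
exists (us + b), us, ys; split => //.
have [r0 _] := residuals_to0 S0.
have := tendsD r0 (tendsD (tends_subseq (cvg_addnl 1%N) ten_u) (tends_cst b)); rewrite add0r.
by congr (tends _ _); apply/funext => n; apply/funext => k; rewrite /r !fctE/=; ring.
Qed.

End Splitting.

(** * Multipliers of convex quadratic constraints *)

Section Multipliers.
Context {R : realType} {I P : finType} {J : P -> finType}.
Context (l : I -> R) (a : (I -> R) -> (P -> R)) (D : forall p, (I -> R) -> (J p -> R)).
Arguments D : clear implicits.
Hypothesis lin_a : linear a.
Hypothesis lin_D : forall p, linear (D p).
Implicit Types (x v : I -> R) (p : P) (e : R).

Definition constr p x : R := a x p + dot (D p x) (D p x) / 4.
(** The derivative of [constr p] at [x] in the direction [v]. *)
Definition dconstr p x v : R := a v p + dot (D p x) (D p v) / 2.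
Definition penalized e x : R :=
  dot l x + (2 * e)^-1 * \sum_p Num.max 0 (constr p x) ^+ 2.

Hypothesis slater : exists x, forall p, constr p x < 0.
Context (B : R).
Hypothesis coercive : forall x, penalized 1 x <= 0 -> exists x',
  [/\ dot l x' = dot l x, forall p, constr p x' = constr p x & forall i, `|x' i| <= B].

Lemma constrD p x v (t : R) : constr p (x + t *: v) =
  constr p x + (t * dconstr p x v + t ^+ 2 * (dot (D p v) (D p v) / 4)).
Proof.
rewrite /constr /dconstr (linear_famD _ _ lin_a) (linear_famD _ _ (lin_D p)).
rewrite (linear_famZ _ _ lin_a) (linear_famZ _ _ (lin_D p)).
rewrite !(dotDl, dotDr, dotZl, dotZr) (dotC (D p v) (D p x)) fctE scale_famE.
by field.
Qed.

(** The squared positive part has a Lipschitz derivative; this replaces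
    differentiation of the penalty. *)
Lemma max0_sqrD (s d : R) : Num.max 0 (s + d) ^+ 2 <=
  Num.max 0 s ^+ 2 + 2 * Num.max 0 s * d + d ^+ 2.
Proof.
have -> : Num.max 0 s ^+ 2 + 2 * Num.max 0 s * d + d ^+ 2 = (Num.max 0 s + d) ^+ 2 by ring.
have [sd0|sd0] := leP (s + d) 0; first by rewrite expr0n/= sqr_ge0.
have sm : s <= Num.max 0 s by rewrite le_max lexx orbT.
by rewrite ler_pXn2r ?nnegrE ?(ltW sd0)//; lra.
Qed.

Lemma cvg_max0 (u : nat -> R) r : u @ \oo --> r ->
  Num.max 0 (u n) @[n --> \oo] --> Num.max 0 r.
Proof.
move=> ur; rewrite maxr_absE (_ : (fun n => _) = fun n => (0 + u n + `|0 - u n|) / 2).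
  apply: cvgM; last exact: cvg_cst.
  by apply: cvgD; [apply: cvgD|apply: cvg_norm; apply: cvgB] => //; exact: cvg_cst.
by apply/funext => n; rewrite maxr_absE.
Qed.

Lemma cvg_constr p (u : nat -> I -> R) x : tends u x ->
  constr p (u n) @[n --> \oo] --> constr p x.
Proof.
move=> ux; apply: cvgD; first exact: (tends_linear lin_a ux).
apply: cvgM; last exact: cvg_cst.
by apply: cvg_dot; exact: tends_linear.
Qed.

Lemma cvg_penalized e (u : nat -> I -> R) x : tends u x ->
  penalized e (u n) @[n --> \oo] --> penalized e x.
Proof.
move=> ux; apply: cvgD; first by apply: cvg_dot => //; exact: tends_cst.
apply: cvgM; first exact: cvg_cst.
apply: cvg_sumr => p; rewrite expr2; under eq_fun do rewrite expr2.
by apply: cvgM; apply: cvg_max0; exact: cvg_constr.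
Qed.

Lemma dot_ge_bound x : (forall i, `|x i| <= B) -> - (\sum_i `|l i| * B) <= dot l x.
Proof.
move=> xB; rewrite lerNl -sumrN; apply: ler_sum => i _.
apply: le_trans (ler_norm _) _; rewrite normrN normrM.
by rewrite ler_wpM2l.
Qed.

(** A minimizing sequence may be replaced by a bounded one with the same
    values, so it has a cluster point. *)
Lemma penalized_min e : 0 < e <= 1 -> exists x,
  (forall i, `|x i| <= B) /\ forall y, penalized e x <= penalized e y.
Proof.
move=> /andP[e0 e1].
have repr x : penalized e x <= 0 -> exists x', penalized e x' = penalized e x /\
    forall i, `|x' i| <= B.
  move=> x0; have [|x' [lx' cx' Bx']] := coercive (x := x).
    apply: le_trans x0; rewrite lerD2l ler_wpM2r ?sumr_ge0// => [p _|].
      exact: sqr_ge0.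
    by rewrite lef_pV2 ?posrE ?mulr_gt0// mulr1 ger_pMr.
  exists x'; split => //; rewrite /penalized lx'; congr (_ + _ * _).
  by apply: eq_bigr => p _; rewrite cx'.
pose S := [set r | exists x, r = penalized e x /\ penalized e x <= 0].
have constr0 p : constr p 0 = 0.
  by rewrite /constr (linear_fam0 lin_a) (linear_fam0 (lin_D p)) dot0l mul0r addr0.
have pen0 : penalized e 0 = 0.
  rewrite /penalized dot0r add0r big1 ?mulr0// => p _.
  by rewrite constr0 maxxx expr0n.
have S0 : S 0 by exists 0; rewrite pen0.
have lbS : lbound S (- (\sum_i `|l i| * B)).
  move=> _ [x [-> /repr[x' [<- Bx']]]]; rewrite /penalized.
  apply: le_trans (dot_ge_bound Bx') _; rewrite lerDl mulr_ge0//.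
    by rewrite invr_ge0 mulr_ge0// ltW.
  by apply: sumr_ge0 => p _; exact: sqr_ge0.
have infS : has_inf S by split; [exists 0|exists (- (\sum_i `|l i| * B))].
have ex_seq n : exists x, penalized e x < inf S + harmonic n /\ forall i, `|x i| <= B.
  have [|_ [x [-> /repr[x' [<- Bx']]]] lt_x'] := inf_adherent (eps := harmonic n) _ infS.
    by rewrite /harmonic invr_gt0.
  by exists x'.
have [u /all_and2[u_lt uB]] := choice ex_seq.
have [f [fo [x ux]]] := bounded_subseq uB.
have x_le : penalized e x <= inf S.
  have h1 := cvg_penalized (e := e) ux.
  have h2 : inf S + harmonic (f n) @[n --> \oo] --> inf S + 0.
    apply: cvgD; first exact: cvg_cst.
    apply: (cvg_comp f (@harmonic R) fo); exact: cvg_harmonic.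
  rewrite addr0 in h2; apply: (ler_cvg_to h1 h2).
  by apply: nearW => n; exact/ltW/u_lt.
exists x; split.
  by move=> i; apply: (cvgr_to_le (cvg_norm (ux i))); apply: nearW => n; exact: uB.
move=> y; apply: le_trans x_le _.
have [y0|/ltW y0] := leP (penalized e y) 0.
  by apply: ge_inf; [exact: infS.2|exists y].
by apply: le_trans y0; apply: ge_inf => //; exact: infS.2.
Qed.

(** The quantities [max 0 (constr p x) / e] play the part of multipliers: the
    quadratic upper bound of the penalty gives one inequality in every
    direction, and the opposite direction gives the other. *)
Lemma penalized_stationary e x v : 0 < e -> (forall y, penalized e x <= penalized e y) ->
  dot l v + \sum_p e^-1 * Num.max 0 (constr p x) * dconstr p x v = 0.
Proof.
move=> e0 xmin.
have half w : 0 <= dot l w + \sum_p e^-1 * Num.max 0 (constr p x) * dconstr p x w.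
  pose q p := dot (D p w) (D p w) / 4.
  apply: (@linear_ineq_slope _ _ ((2 * e)^-1 * \sum_p
    (2 * Num.max 0 (constr p x) * q p + 2 * dconstr p x w ^+ 2 + 2 * q p ^+ 2))).
  move=> t /andP[t0 t1]; have := xmin (x + t *: w).
  rewrite -subr_ge0 => /le_trans; apply.
  rewrite /penalized dotDr dotZr.
  have -> : dot l x + t * dot l w + (2 * e)^-1 * \sum_p Num.max 0 (constr p (x + t *: w)) ^+ 2
      - (dot l x + (2 * e)^-1 * \sum_p Num.max 0 (constr p x) ^+ 2) =
      t * dot l w + (2 * e)^-1 * (\sum_p Num.max 0 (constr p (x + t *: w)) ^+ 2
      - \sum_p Num.max 0 (constr p x) ^+ 2) by ring.
  rewrite [in leRHS]mulrDr -[in leRHS]addrA lerD2l [in leRHS](mulrCA (t ^+ 2)).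
  have -> : \sum_p e^-1 * Num.max 0 (constr p x) * dconstr p x w =
      (2 * e)^-1 * \sum_p 2 * Num.max 0 (constr p x) * dconstr p x w.
    by rewrite mulr_sumr; apply: eq_bigr => p _; field; exact: lt0r_neq0.
  rewrite [in leRHS](mulrCA t) -[in leRHS]mulrDr ler_pM2l ?invr_gt0 ?mulr_gt0//.
  rewrite -sumrB !mulr_sumr -big_split; apply: ler_sum => p _ /=.
  rewrite constrD lerBlDl; apply: le_trans (max0_sqrD _ _) _.
  rewrite -/(q p); set g' := dconstr p x w; set m := Num.max _ _.
  (* The remaining inequality is [(g' + t q)^2 <= 2 g'^2 + 2 q^2] for
     [0 < t <= 1], times [t ^+ 2]. *)
  have : 0 <= t ^+ 2 * (g' - t * q p) ^+ 2 by rewrite mulr_ge0 ?sqr_ge0.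
  have : 0 <= t ^+ 2 * (1 - t ^+ 2) * q p ^+ 2.
    apply: mulr_ge0; last exact: sqr_ge0.
    by apply: mulr_ge0; rewrite ?sqr_ge0// subr_ge0 exprn_ile1// ltW.
  lra.
apply/eqP; rewrite eq_le half andbT -oppr_ge0.
have := half (- v); rewrite dotNr.
suff -> : \sum_p e^-1 * Num.max 0 (constr p x) * dconstr p x (- v) =
    - \sum_p e^-1 * Num.max 0 (constr p x) * dconstr p x v by rewrite opprD.
rewrite -sumrN; apply: eq_bigr => p _; rewrite -mulrN; congr (_ * _).
rewrite /dconstr -scaleN1r (linear_famZ _ _ lin_a) (linear_famZ _ _ (lin_D p)) dotZr scale_famE.
by rewrite !mulN1r mulNr opprD.
Qed.

(** Quadratic penalty method with [e = 1 / n.+1].  Testing stationarity in the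
    direction of a Slater point bounds the approximate multipliers, and
    [max 0 (constr p x) = e * m p] forces feasibility and complementarity in the
    limit [e -> 0]. *)
Theorem multipliers_exist : exists x (m : P -> R),
  [/\ forall p, 0 <= m p, forall p, constr p x <= 0, forall p, m p * constr p x = 0 &
      forall v, dot l v + \sum_p m p * dconstr p x v = 0].
Proof.
have [x0 sl] := slater.
have ex n : exists x, (forall i, `|x i| <= B) /\
    forall y, penalized (harmonic n) x <= penalized (harmonic n) y.
  apply: penalized_min; rewrite /harmonic invr_gt0 ltr0Sn/=.
  by rewrite invf_le1// ler1n.
have [u /all_and2[uB umin]] := choice ex.
pose m n p := (harmonic n)^-1 * Num.max 0 (constr p (u n)).
have stat n v : dot l v + \sum_p m n p * dconstr p (u n) v = 0.
  by apply: penalized_stationary => //; rewrite /harmonic invr_gt0.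
have m_ge0 n p : 0 <= m n p.
  by rewrite mulr_ge0 ?le_max ?lexx// invr_ge0 /harmonic invr_ge0.
pose C := dot l x0 + \sum_i `|l i| * B.
have m_bound n p : m n p <= C / - constr p x0.
  rewrite ler_pdivlMr ?oppr_gt0//.
  have slack q : 0 <= m n q * - constr q x0 by rewrite mulr_ge0// oppr_ge0 ltW.
  apply: (@le_trans _ _ (\sum_q m n q * - constr q x0)).
    by rewrite (bigD1 p)//= lerDl sumr_ge0.
  apply: (@le_trans _ _ (dot l (x0 - u n))); last first.
    by rewrite dotBr lerD2l lerNl dot_ge_bound.
  have -> : dot l (x0 - u n) = \sum_q m n q * - dconstr q (u n) (x0 - u n).
    under eq_bigr do rewrite mulrN.
    by rewrite sumrN; apply/eqP; rewrite -addr_eq0; apply/eqP/stat.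
  apply: ler_sum => q _; rewrite !mulrN lerN2.
  (* By convexity the derivative towards the Slater point [x0] is at most
     [constr q x0 - constr q (u n)]. *)
  have -> : constr q x0 = constr q (u n + 1 *: (x0 - u n)).
    by rewrite scale1r addrC subrK.
  rewrite constrD mul1r expr1n mul1r.
  have mg : 0 <= m n q * constr q (u n).
    rewrite /m -mulrA mulr_ge0 ?invr_ge0 ?/harmonic ?invr_ge0//.
    by have [?|/ltW ?] := leP (constr q (u n)) 0; rewrite ?mul0r ?mulr_ge0.
  rewrite [leRHS]mulrDr (mulrDr (m n q) (dconstr _ _ _)) addrCA lerDl addr_ge0//
    mulr_ge0// divr_ge0 ?dot_ge0//.
have bnd n i : `|stack (u n) (m n) i| <= `|B| + \sum_p `|C / - constr p x0|.
  case: i => [i|p] /=.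
    apply: le_trans (uB n i) _; apply: le_trans (ler_norm _) _.
    by rewrite lerDl sumr_ge0.
  rewrite ger0_norm//; apply: le_trans (m_bound n p) _; apply: le_trans (ler_norm _) _.
  by rewrite (bigD1 p)//= addrCA lerDl addr_ge0// sumr_ge0.
have [f [fo [xm fx]]] := bounded_subseq bnd.
pose x := fst_part xm; pose mm := snd_part xm.
have fu : tends (u \o f) x by move=> i; exact: (fx (inl i)).
have fm p : m (f n) p @[n --> \oo] --> mm p by exact: (fx (inr p)).
have h0 : harmonic (f n) @[n --> \oo] --> (0 : R).
  apply: (cvg_comp f (@harmonic R) fo); exact: cvg_harmonic.
have maxE n p : Num.max 0 (constr p (u n)) = harmonic n * m n p.
  by rewrite /m mulrA divff ?mul1r// /harmonic invr_eq0.
have max0 p : Num.max 0 (constr p x) = 0.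
  have h1 := cvg_max0 (cvg_constr (p := p) fu).
  have h2 := cvgM h0 (fm p); rewrite mul0r in h2.
  rewrite -(cvg_lim _ h1)//; apply/cvg_lim => //.
  rewrite (_ : (fun n => Num.max 0 (constr p ((u \o f) n))) =
    fun n => harmonic (f n) * m (f n) p); first exact: h2.
  by apply/funext => n; exact: maxE.
exists x, mm; split.
- by move=> p; apply: (cvgr_to_ge (fm p)); exact: nearW.
- by move=> p; rewrite -(max0 p) le_max lexx orbT.
- move=> p.
  have h1 : m (f n) p * constr p (u (f n)) @[n --> \oo] --> mm p * constr p x.
    exact: (cvgM (fm p) (cvg_constr (p := p) fu)).
  have h2 : m (f n) p * (harmonic (f n) * m (f n) p) @[n --> \oo] --> mm p * (0 * mm p).
    exact: (cvgM (fm p) (cvgM h0 (fm p))).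
  rewrite mul0r mulr0 in h2; rewrite -(cvg_lim _ h1)//; apply/cvg_lim => //.
  rewrite (_ : (fun n => m (f n) p * constr p (u (f n))) =
    fun n => m (f n) p * (harmonic (f n) * m (f n) p)); first exact: h2.
  apply/funext => n; rewrite -maxE /m.
  by have [_|//] := leP (constr p (u (f n))) 0; rewrite mulr0 !mul0r.
- move=> v; have h : dot l v + \sum_p m (f n) p * dconstr p (u (f n)) v @[n --> \oo]
      --> dot l v + \sum_p mm p * dconstr p x v.
    apply: cvgD; first exact: cvg_cst.
    apply: cvg_sumr => p; apply: cvgM => //; apply: cvgD; first exact: cvg_cst.
    apply: cvgM; last exact: cvg_cst.
    by apply: cvg_dot; [exact: (tends_linear (lin_D p) fu)|exact: tends_cst].
  rewrite -(cvg_lim _ h)//; apply/cvg_lim => //.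
  by under eq_fun do rewrite stat; exact: cvg_cst.
Qed.

End Multipliers.

(** * Geometry of the mesh *)

Section Geometry.
Context {R : realType} {M : mesh_data R}.
Hypothesis hM : is_mesh M.
Local Notation V := (vertex M).
Local Notation T := (face M).
Implicit Types (f g : T) (v : V).

Lemma gram_unit f : ((jac f)^T *m jac f) \in unitmx.
Proof.
rewrite -row_free_unit -kermx_eq0 -submx0; apply/rV_subP => u /sub_kermxP uG.
have uJ : u *m (jac f)^T = 0.
  by apply: row_mul_tr_eq0; rewrite trmx_mul trmxK !mulmxA -(mulmxA u) uG mul0mx.
have : row_free (jac f)^T by rewrite /row_free mxrank_tr mesh_nondegenerate.
by move=> /row_free_inj fr; rewrite submx0; apply/eqP/fr; rewrite uJ mul0mx.
Qed.

(** Nonnegativity is the Cauchy-Schwarz inequality for the two columns. *)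
Lemma det_gram_gt0 f : 0 < \det ((jac f)^T *m jac f).
Proof.
rewrite lt_def; apply/andP; split; first by have := gram_unit f; rewrite unitmxE unitfE.
have detE (A : 'M[R]_2) : \det A = A 0 0 * A 1 1 - A 0 1 * A 1 0.
  rewrite (expand_det_row _ ord0) !big_ord_recl big_ord0 /cofactor !det_mx11 !mxE /=.
  rewrite expr0 expr1 mul1r addr0 mulN1r mulrN.
  by congr (A _ _ * A _ _ - A _ _ * A _ _); apply: val_inj.
have gramE i j : ((jac f)^T *m jac f) i j = dot ((jac f)^~ i) ((jac f)^~ j).
  by rewrite mxE; apply: eq_bigr => k _; rewrite mxE.
by rewrite detE !gramE (dotC _ ((jac f)^~ 0)) -expr2 subr_ge0 sqr_dot_le.
Qed.

Lemma area_gt0 f : 0 < area f.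
Proof. by rewrite divr_gt0// sqrtr_gt0 det_gram_gt0. Qed.

Lemma varea_gt0 v : 0 < varea v.
Proof.
rewrite mulr_gt0 ?invr_gt0//; have [f [i fi]] := mesh_cover hM v.
rewrite (bigD1 f) /=; last by rewrite inE; apply/existsP; exists i; rewrite fi.
by rewrite ltr_pwDl ?area_gt0// sumr_ge0// => g _; rewrite ltW// area_gt0.
Qed.

(** The gradient of the interpolant determines the differences of its nodal
    values, because the Gram matrix of the edges is invertible. *)
Lemma hat_grad_eq0 f (x : 'I_3 -> R) :
  (forall a, \sum_(i < 3) x i * hat_grad f a i = 0) -> forall i j, x i = x j.
Proof.
move=> h; pose X : 'cV[R]_3 := \col_i x i.
have hX : hat_grad f *m X = 0.
  apply/colP => a; rewrite mxE [RHS]mxE -[RHS](h a); apply: eq_bigr => i _.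
  by rewrite [X _ _]mxE mulrC.
pose D : 'M[R]_(2, 3) := row_mx (const_mx (-1) : 'cV[R]_2) 1%:M.
have DX : D *m X = 0.
  have := congr1 (mulmx (jac f)^T) hX.
  by rewrite /hat_grad -/D mulmx0 !mulmxA mulmxV ?gram_unit// mul1mx.
have XE : X = col_mx (const_mx (x 0) : 'cV_1) (\col_(k < 2) x (rshift 1 k)).
  apply/colP => i; rewrite mxE mxE; case: (@splitP 1 2 i) => k ik; rewrite mxE.
    by congr x; apply: val_inj; rewrite /= ik (ord1 k).
  by congr x; apply: val_inj.
have x0 (k : 'I_2) : x (rshift 1 k) = x 0.
  have : D *m X = const_mx (-1) *m (const_mx (x 0) : 'cV_1) + \col_(k < 2) x (rshift 1 k).
    rewrite XE -[Y in _ = _ + Y]mul1mx.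
    by etransitivity; first exact: (@mul_row_col _ 2 1 2 1).
  rewrite DX => /esym/matrixP/(_ k 0).
  by rewrite !mxE big_ord1 !mxE mulN1r addrC => /eqP; rewrite subr_eq0 => /eqP.
suff x0' i : x i = x 0 by move=> i j; rewrite !x0'.
case: (@splitP 1 2 i) => [k ik|k ik].
  by congr x; apply: val_inj; rewrite /= ik (ord1 k).
by rewrite -(x0 k); congr x; apply: val_inj.
Qed.

(** A triangle is the image of a compact simplex. *)
Lemma closed_triangle f : closed (triangle f).
Proof.
pose K := [set t : 'rV[R]_3 | forall i, `[0, 1]%classic (t ord0 i)].
pose S := [set t : 'rV[R]_3 | \sum_i t ord0 i = 1].
pose g (t : 'rV[R]_3) := \sum_i t ord0 i *: pos (corner f i).
have cS : closed S.
  apply: (@preimage_closed _ _ (fun t : 'rV[R]_3 => \sum_i t ord0 i) [set 1]).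
    move=> t _; apply: (@cvg_sumr _ _ (nbhs t) (nbhs_filter t)) => i.
    exact: coord_continuous.
  exact: closed_eq.
have cK : compact K.
  have h := @rV_compact R 3 (fun=> `[0, 1]%classic).
  by apply: h => i; exact: segment_compact.

have cg : continuous g.
  have addc : continuous (fun x : 'cV[R]_3 * 'cV[R]_3 => x.1 + x.2).
    by move=> x; exact: add_continuous.
  move=> t; apply: (@cvg_big _ _ _ _ _ addc _ (nbhs t) _ _ _ (nbhs_filter t)).
  by move=> i _; apply: (@cvgZr_tmp _ _ _ (nbhs t) (nbhs_filter t)); exact: coord_continuous.
have -> : triangle f = g @` (K `&` S).
  apply/seteqP; split => [x [t [t0 t1 ->]]|_ [t [tK tS] <-]].
    exists (\row_i t i).
      split; last by rewrite /S /= -t1; apply: eq_bigr => i _; rewrite mxE.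
      move=> i; rewrite /= in_itv /= mxE t0/= -t1 (bigD1 i)//= lerDl.
      exact: sumr_ge0.
    by apply: eq_bigr => i _; rewrite mxE.
  exists (fun i => t ord0 i); split => // i.
  by have := tK i; rewrite /= in_itv /= => /andP[].
apply: compact_closed; first exact: norm_hausdorff.
apply: continuous_compact; first exact: continuous_subspaceT.
exact: compact_closedI.
Qed.

Lemma meeting_triangles f g : triangle f `&` triangle g !=set0 ->
  exists i j, corner f i = corner g j.
Proof.
move=> [x fgx]; have [->|fg] := eqVneq f g; first by exists 0, 0.
case: (mesh_meet hM fg) => [E|[i [j [ij _]]]|[i [i' [j [j' [_ ij _ _]]]]]].
- by move: fgx; rewrite E.
- by exists i, j.
- by exists i, j.
Qed.

Lemma corner_in_triangle f i : triangle f (pos (corner f i)).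
Proof.
exists (fun j => (j == i)%:R); split=> [j| |]; first exact: ler0n.
  by rewrite (bigD1 i)//= eqxx big1 ?addr0// => j /negbTE ->.
by rewrite (bigD1 i)//= eqxx scale1r big1 ?addr0// => j /negbTE ->; rewrite scale0r.
Qed.

(** Topological connectedness gives combinatorial connectedness.  The triangles
    that carry the value [x v] and those that do not have closed unions; these
    are disjoint, because triangles that meet share a vertex. *)
Lemma mesh_const (x : V -> R) : (forall f i j, x (corner f i) = x (corner f j)) ->
  forall v v', x v = x v'.
Proof.
move=> xc v v'.
have [f [i fi]] := mesh_cover hM v; have [f' [i' fi']] := mesh_cover hM v'.
pose W (b : bool) := \bigcup_(g in [set g | (x (corner g 0) == x v) = b]) triangle g.
have clW b : closed (W b).
  by apply: closed_bigcup => [|g _]; [exact: finite_finset|exact: closed_triangle].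
pose X := \bigcup_(g in [set: T]) triangle g.
have W_disj y : W true y -> W false y -> False.
  move=> [g /= gv gy] [g' /= gv' gy'].
  have [|k [k' kk']] := @meeting_triangles g g'; first by exists y.
  by move: gv'; rewrite (xc g' 0 k') -kk' (xc g k 0) gv.
have XW : X = W true `|` W false.
  apply/seteqP; split => [y [g _ gy]|y [] [g _ gy]]; last by exists g.
    case gv : (x (corner g 0) == x v); [left|right]; exists g => //.
  by exists g.
have WX : W true = X.
  apply: (mesh_connected hM).
  - exists (pos v); exists f; first by rewrite /= -fi (xc f 0 i) eqxx.
    rewrite -fi; exact: corner_in_triangle.
  - exists (~` W false); first exact/closed_openC/clW.
    apply/seteqP; split => [y Wy|y []].
      by rewrite -/X XW; split; [left|move=> /W_disj; exact].
    by rewrite -/X XW => -[].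
  - by exists (W true) => //; rewrite -/X XW setIUl setIid; apply/esym/setUidl => y [].
have : W true (pos v').
  by rewrite WX; exists f' => //; rewrite -fi'; exact: corner_in_triangle.
move=> [g /= /eqP gv gv'].
have [|k [k' kk']] := @meeting_triangles g f'.
  by exists (pos v'); split => //; rewrite -fi'; exact: corner_in_triangle.
by rewrite -gv -fi' (xc f' i' k') -kk' (xc g k 0).
Qed.

End Geometry.

(** * Bounded sublevel sets from a strictly positive dual point *)

Section Coercive.
Context {R : realType} {I P J : finType} {Q : P -> finType}.
Context (l : I -> R) (a : (I -> R) -> (P -> R)) (S : (I -> R) -> (J -> R)).
Context (D : forall p, (P + J -> R) -> (Q p -> R)).
Arguments D : clear implicits.
Hypothesis lin_a : linear a.
Hypothesis lin_S : linear S.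
Hypothesis lin_D : forall p, linear (D p).
Context (w : P -> R) (mu : J -> R).
Hypothesis w_gt0 : forall p, 0 < w p.

Let A x := stack (a x) (S x).
(** The constraints depend on [x] only through [A x], so that points may be
    replaced by bounded ones with the same image. *)
Definition pulled_form (p : P) (x : I -> R) : Q p -> R := D p (A x).
Arguments pulled_form : clear implicits.

Hypothesis objective : forall x, dot l x = - (\sum_p w p * a x p) - dot (S x) mu.
Hypothesis cover : forall j, exists C, 0 <= C /\ forall x,
  S x j ^+ 2 <= C * \sum_p w p * dot (pulled_form p x) (pulled_form p x).
Hypothesis slater : exists x, forall p, constr a pulled_form p x < 0.

Let lin_A : linear A.
Proof.
by move=> r x y; apply/funext => -[p|j]; rewrite /A /= ?lin_a ?lin_S.
Qed.

Lemma linear_pulled_form p : linear (pulled_form p).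
Proof. by move=> r x y; rewrite /pulled_form lin_A lin_D. Qed.

Let G x := \sum_p w p * dot (pulled_form p x) (pulled_form p x).

Let G_ge0 x : 0 <= G x.
Proof. by apply: sumr_ge0 => p _; rewrite mulr_ge0 ?dot_ge0// ltW. Qed.

Lemma cover_all : exists C, 0 < C /\ forall x, dot (S x) (S x) <= C * G x.
Proof.
have [C CP] := choice cover; exists (1 + \sum_j C j); split.
  by rewrite ltr_pwDl// sumr_ge0// => j _; exact: (CP j).1.
move=> x; rewrite mulrDl mul1r mulr_suml (le_trans _ (_ : \sum_j C j * G x <= _)) ?lerDr//.
by apply: ler_sum => j _; rewrite -expr2; exact: (CP j).2.
Qed.

(** The hypothesis [objective] writes the linear form as a Lagrangian with
    strictly positive weights [w].  The penalized function is then at least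
    [sum_p w p |constr p x| + (1/8) sum_p w p |D p x|^2] minus a constant, where
    [mu] is absorbed by Young's inequality; this controls [a] and [S]. *)
Lemma sublevel_bounded : exists E, forall x, penalized l a pulled_form 1 x <= 0 ->
  forall i, `|A x i| <= E.
Proof.
have [C [C0 CP]] := cover_all.
pose E0 := 2 * (\sum_p w p ^+ 2) + 2 * C * dot mu mu.
have E0_ge0 : 0 <= E0.
  by rewrite addr_ge0 ?mulr_ge0 ?dot_ge0 ?sumr_ge0 ?ltW// => p _; exact: sqr_ge0.
have main x : penalized l a pulled_form 1 x <= 0 ->
    \sum_p w p * `|constr a pulled_form p x| + G x / 8 <= E0.
  rewrite /penalized objective mulr1 => h.
  have young : dot (S x) mu <= G x / 8 + 2 * C * dot mu mu.
    have := dot_ge0 (S x - (4 * C) *: mu).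
    rewrite dotBl !dotBr !dotZl !dotZr (dotC mu) => h1.
    rewrite -(ler_pM2l (_ : 0 < 8 * C)) ?mulr_gt0//.
    have := CP x; have : 0 <= C * C * dot mu mu by rewrite !mulr_ge0 ?dot_ge0// ltW.
    lra.
  have pen : \sum_p w p * `|constr a pulled_form p x| - 2 * (\sum_p w p ^+ 2) + G x / 4 <=
      - (\sum_p w p * a x p) + 2^-1 * \sum_p Num.max 0 (constr a pulled_form p x) ^+ 2.
    rewrite -sumrN !mulr_sumr mulr_suml -sumrB -!big_split; apply: ler_sum => p _ /=.
    have : constr a pulled_form p x = a x p + dot (pulled_form p x) (pulled_form p x) / 4 by [].
    move: (constr _ _ _ _) (dot (pulled_form p x) _) => g d gE.
    have -> : a x p = g - d / 4 by lra.
    have wp := w_gt0 p.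
    have [g0|g0] := leP g 0; first by rewrite ler0_norm//; have := sqr_ge0 (w p); lra.
    by rewrite gtr0_norm//; have := sqr_ge0 (g - 2 * w p); lra.
  rewrite /E0; lra.
(* The three terms bound the constraint values, the quadratic parts and the
   coordinates of [S x]. *)
pose E1 := \sum_p (E0 / w p) + 2 * \sum_p (E0 / w p) + Num.sqrt (C * (8 * E0)).
exists E1 => x /main h.
have sum_ge0 : 0 <= \sum_p w p * `|constr a pulled_form p x|.
  by apply: sumr_ge0 => p _; rewrite mulr_ge0// ltW.
have E0w_ge0 : 0 <= \sum_p E0 / w p by apply: sumr_ge0 => p _; rewrite divr_ge0// ltW.
have G_le : G x <= 8 * E0 by lra.
have GE := G_ge0 x.
have le_sum (F : P -> R) p : (forall p, 0 <= F p) -> F p <= \sum_p F p.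
  by move=> F0; rewrite (bigD1 p)//= lerDl sumr_ge0.
case=> [p|j] /=.
  have g_le : `|constr a pulled_form p x| <= \sum_p E0 / w p.
    apply: le_trans (le_sum (fun p => E0 / w p) p _); last by move=> q; rewrite divr_ge0// ltW.
    rewrite ler_pdivlMr// mulrC.
    apply: (le_trans (le_sum (fun p => w p * `|constr a pulled_form p x|) p _)).
      by move=> q; rewrite mulr_ge0// ltW.
    by apply: le_trans h; rewrite lerDl divr_ge0.
  have d_le : dot (pulled_form p x) (pulled_form p x) / 4 <= 2 * \sum_p E0 / w p.
    suff : dot (pulled_form p x) (pulled_form p x) / 8 <= \sum_p E0 / w p by lra.
    apply: le_trans (le_sum (fun p => E0 / w p) p _); last by move=> q; rewrite divr_ge0// ltW.
    rewrite ler_pdivlMr// mulrAC ler_pdivrMr// (mulrC E0).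
    apply: le_trans G_le; rewrite mulrC.
    apply: (le_sum (fun p => w p * dot (pulled_form p x) (pulled_form p x))).
    by move=> q; rewrite mulr_ge0 ?dot_ge0// ltW.
  have -> : a x p = constr a pulled_form p x - dot (pulled_form p x) (pulled_form p x) / 4.
    by rewrite /constr addrK.
  apply: le_trans (ler_normB _ _) _.
  have d0 : 0 <= dot (pulled_form p x) (pulled_form p x) / 4 by rewrite divr_ge0// dot_ge0.
  rewrite (ger0_norm d0) /E1.
  by have := sqrtr_ge0 (C * (8 * E0)); lra.
rewrite -sqrtr_sqr; apply: (@le_trans _ _ (Num.sqrt (C * (8 * E0)))).
  apply: ler_wsqrtr; apply: le_trans (sqr_le_dot _ _) _; apply: le_trans (CP x) _.
  by rewrite ler_pM2l.
by rewrite /E1 lerDr addr_ge0// mulr_ge0.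
Qed.

Theorem coercive_multipliers : exists x (m : P -> R),
  [/\ forall p, 0 <= m p, forall p, constr a pulled_form p x <= 0,
      forall p, m p * constr a pulled_form p x = 0 &
      forall v, dot l v + \sum_p m p * dconstr a pulled_form p x v = 0].
Proof.
have [E EP] := sublevel_bounded; have [inv [lin_inv invK _]] := linear_pinv lin_A.
pose B := \sum_i \sum_j E * `|adj inv (unit_vec i) j|.
apply: (multipliers_exist lin_a linear_pulled_form slater (B := B)).
move=> x /EP Ax; exists (inv (A x)).
have aE : a (inv (A x)) = a x.
  by apply/funext => p; have := congr1 (fun f : P + J -> R => f (inl p)) (invK x).
have SE : S (inv (A x)) = S x.
  by apply/funext => j; have := congr1 (fun f : P + J -> R => f (inr j)) (invK x).
split; first by rewrite !objective aE SE.
  by move=> p; rewrite /constr /pulled_form invK aE.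
move=> i; rewrite linear_coordE//.
apply: (@le_trans _ _ (\sum_j E * `|adj inv (unit_vec i) j|)).
  apply: le_trans (ler_norm_sum _ _ _) _; apply: ler_sum => j _.
  by rewrite normrM ler_wpM2r.
rewrite /B (bigD1 i)//= lerDl; apply: sumr_ge0 => k _; apply: sumr_ge0 => j _.
by rewrite mulr_ge0//; exact: le_trans (normr_ge0 _) (Ax j).
Qed.

End Coercive.
Arguments pulled_form {R I P J Q} a S D p x.

(** * The operators and the cone of the program *)

Section Operators.
Context {R : realType} {M : mesh_data R} {N : nat}.
Hypothesis hM : is_mesh M.
Hypothesis hN : (1 <= N)%N.
Local Notation V := (vertex M).
Local Notation T := (face M).

Let N_gt0 : 0 < N%:R :> R. Proof. by rewrite ltr0n. Qed.

Definition wq : qI M N -> R := Wq (fun=> 1).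
Definition wz : zI M N -> R := Wz (fun=> 1).

Lemma WqE (x : qI M N -> R) : Wq x = weigh wq x.
Proof. by apply/funext => -[[k v]|[[k f] i]]; rewrite /wq /weigh/= mulr1. Qed.

Lemma WzE (x : zI M N -> R) : Wz x = weigh wz x.
Proof.
by apply/funext => -[[k v]|[[s [[k f] i]]|[k v]]]; rewrite /wz /weigh/= mulr1.
Qed.

Lemma dot_qE (x y : qI M N -> R) : dot_q x y = wdot wq x y.
Proof. by rewrite /dot_q WqE. Qed.

Lemma dot_zE (x y : zI M N -> R) : dot_z x y = wdot wz x y.
Proof. by rewrite /dot_z WzE. Qed.

Lemma wq_gt0 i : 0 < wq i.
Proof.
by case: i => [[k v]|[[k f] i]]; rewrite /wq /= mulr1 divr_gt0 ?varea_gt0 ?area_gt0.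
Qed.

Lemma wz_gt0 i : 0 < wz i.
Proof.
by case: i => [[k v]|[[s [[k f] i]]|[k v]]];
  rewrite /wz /= mulr1 divr_gt0 ?varea_gt0 ?area_gt0.
Qed.

Lemma linear_opAt : linear (@opAt R M N).
Proof. by move=> r x y; apply/funext => -[k v]; rewrite /opAt !fctE /GRing.scale /=; ring. Qed.

Lemma linear_opAs : linear (@opAs R M N).
Proof.
move=> r x y; apply/funext => -[[k f] a]; rewrite /opAs !fctE /GRing.scale /=.
rewrite mulr_sumr -big_split; apply: eq_bigr => i _ /=.
ring.
Qed.

Lemma linear_opA : linear (@opA R M N).
Proof.
move=> r x y; apply/funext => -[p|j]; rewrite /opA /=.
  by rewrite linear_opAt.
by rewrite linear_opAs.
Qed.

Definition opBF (q : qI M N -> R) : zI M N -> R := opB (opF q).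

Lemma linear_opF : linear (@opF R M N).
Proof. by move=> r x y; apply/funext => -[kv|[[s i] [[k f] a]]]. Qed.

Lemma linear_opB : linear (@opB R M N).
Proof.
move=> r x y; apply/funext => -[kv|[i|kv]] //.
  change (- (r * x (inl kv) + y (inl kv)) = r * - x (inl kv) + - y (inl kv)); ring.
change (Num.sqrt 3 / 3 * (r * x (inr i) + y (inr i)) =
  r * (Num.sqrt 3 / 3 * x (inr i)) + Num.sqrt 3 / 3 * y (inr i)); ring.
Qed.

Lemma linear_opBF : linear opBF.
Proof. by move=> r x y; rewrite /opBF linear_opF linear_opB. Qed.

Lemma linear_opT : linear (@opT R M N).
Proof.
move=> r x y; apply/funext => -[[k v] [[]|[[[s [f a]] h]|[]]]] //=.
rewrite /opT /opTkv /= /fst_part /snd_part !fctE /GRing.scale /=; ring.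
Qed.

Definition side_index (kv : Vst M N) : finType :=
  {x : six * (T * 'I_3) | corner x.2.1 x.1.2 == kv.2}.

Definition block_part (kv : Vst M N) (y : TI M N -> R) : blockI kv.2 -> R :=
  fun j => y (Tagged (fun kv : Vst M N => blockI kv.2) j).

Lemma dot_TI (x y : TI M N -> R) :
  dot x y = \sum_kv dot (block_part (kv := kv) x) (block_part y).
Proof.
rewrite /dot (sig_big_dep xpredT (fun _ => xpredT)
  (fun kv j => block_part (kv := kv) x j * block_part y j)) /=.
by apply: eq_bigr => -[].
Qed.

Lemma dot_block (v : V) (x y : blockI v -> R) :
  dot x y = fst_part x tt * fst_part y tt + dot (snd_part x) (snd_part y).
Proof. by rewrite /dot big_sumType /= (big_pred1 tt)//= => -[]. Qed.

Lemma soc_dot_ge0 (v : V) (x y : blockI v -> R) : soc x -> soc y -> 0 <= dot x y.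
Proof.
rewrite /soc /= dot_block => hx hy.
have := normr_dot_le (snd_part x) (snd_part y); have := ler_norm (- dot (snd_part x) (snd_part y)).
rewrite normrN => h1 h2.
have : enorm (snd_part x) * enorm (snd_part y) <= fst_part x tt * fst_part y tt.
  by rewrite ler_pM ?sqrtr_ge0.
lra.
Qed.

(** Members of the cone that test whether [y] belongs to it: for [e = 0] they
    give the cone inequality unless the tail of [y] vanishes, and for [e > 0]
    they give the sign of the head in that case. *)
Definition reflected_block (e : R) (v : V) (y : blockI v -> R) : blockI v -> R :=
  stack (fun=> enorm (snd_part y) + e) (- snd_part y).

Lemma enormN (I : finType) (x : I -> R) : enorm (- x) = enorm x.
Proof. by rewrite /enorm dotNl dotNr opprK. Qed.

Lemma sqr_enorm (I : finType) (x : I -> R) : enorm x ^+ 2 = dot x x.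
Proof. by rewrite /enorm sqr_sqrtr ?dot_ge0. Qed.

(** Self-duality, from the Cauchy-Schwarz inequality in one direction and from
    [reflected_block] in the other.  Closedness and convexity of the cone
    follow from this description. *)
Lemma coneQ_dual (y : TI M N -> R) :
  coneQ y <-> forall x, coneQ x -> 0 <= dot x y.
Proof.
split=> [hy x hx|h kv].
  by rewrite dot_TI sumr_ge0// => kv _; apply: soc_dot_ge0; [exact: hx|exact: hy].
rewrite /soc /= -/(block_part y).
set yb := block_part y; set n := enorm _.
have main e : 0 <= e -> n ^+ 2 <= (n + e) * fst_part yb tt.
  move=> e0.
  (* Multiplication by the indicator of the block [kv] avoids a transport
     between the types of different blocks. *)
  pose x (p : TI M N) :=
    (tag p == kv)%:R * reflected_block e (block_part (kv := tag p) y) (tagged p).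
  have /h : coneQ x.
    move=> kv'; rewrite /soc /= /x /=.
    case: eqP => [->|_]; rewrite /fst_part /= ?mul1r ?mul0r.
      rewrite (_ : snd_part _ = - snd_part yb); first by rewrite enormN lerDl.
      by apply/funext => j; rewrite /snd_part /= mul1r.
    rewrite (_ : snd_part _ = 0); last by apply/funext => j; rewrite /snd_part /= mul0r.
    by rewrite /enorm dot0l sqrtr0.
  rewrite dot_TI (bigD1 kv)//= big1 ?addr0 => [|kv' kv'N]; last first.
    rewrite (_ : block_part x = 0) ?dot0l//; apply/funext => j.
    by rewrite /block_part /x /= (negbTE kv'N) mul0r.
  rewrite (_ : block_part x = reflected_block e yb); last first.
    by apply/funext => j; rewrite /block_part /x /= eqxx mul1r.
  by rewrite dot_block /= dotNl -sqr_enorm -/n subr_ge0.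
have n0 : 0 <= n by exact: sqrtr_ge0.
have [nE|nN0] := eqVneq n 0.
  by have := main 1 ler01; rewrite nE expr0n add0r mul1r.
have n_gt0 : 0 < n by rewrite lt_def nN0.
by have := main 0 (lexx _); rewrite addr0 expr2 ler_pM2l.
Qed.

Lemma coneQ_closed (y : nat -> TI M N -> R) y' :
  (forall n, coneQ (y n)) -> tends y y' -> coneQ y'.
Proof.
move=> hy yy'; apply/coneQ_dual => x hx.
apply: (cvgr_to_ge (cvg_dot (tends_cst x) yy')); apply: nearW => n.
exact: (coneQ_dual (y n)).1.
Qed.

Lemma coneQ_comb (a b : R) (x y : TI M N -> R) : 0 <= a -> 0 <= b ->
  coneQ x -> coneQ y -> coneQ (a *: x + b *: y).
Proof.
move=> a0 b0 /coneQ_dual hx /coneQ_dual hy; apply/coneQ_dual => s hs.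
by rewrite dotDr !dotZr addr_ge0// mulr_ge0//; [exact: hx|exact: hy].
Qed.

Lemma coneQ0 : coneQ (0 : TI M N -> R).
Proof. by apply/coneQ_dual => s _; rewrite dot0r. Qed.

(** A coordinate of [D_i] on the triangle [f] occurs in the block of the vertex
    [corner f i], and in no other one. *)
Definition opTinv (y : TI M N -> R) : zI M N -> R :=
  stack (fun kv => y (@Tagged _ kv (fun kv : Vst M N => blockI kv.2) (inl tt)))
   (stack (fun '((s, i), ((k, f), a)) =>
      (Num.sqrt (area f / varea (corner f i)))^-1 *
      y (@Tagged (Vst M N) (k, corner f i) (fun kv => blockI kv.2)
         (inr (inl (exist (fun x : six * (T * 'I_3) => corner x.2.1 x.1.2 == corner f i)
            ((s, i), (f, a)) (eqxx _))))))
    (fun kv => y (@Tagged _ kv (fun kv : Vst M N => blockI kv.2) (inr (inr tt))))).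

Lemma opTK : cancel opTinv (@opT R M N).
Proof.
move=> y; apply/funext => -[[k v] [[]|[[[[s i] [f a]] h]|[]]]] //=.
have /= hv := eqP h; subst v; rewrite /opT /opTkv /= /fst_part /snd_part /=.
rewrite mulrA divff ?mul1r; last first.
  by rewrite gt_eqF// sqrtr_gt0 divr_gt0 ?varea_gt0 ?area_gt0.
by congr (y (Tagged _ (inr (inl (exist _ _ _))))); exact: bool_irrelevance.
Qed.

Lemma opTinvK : cancel (@opT R M N) opTinv.
Proof.
move=> z; apply/funext => -[[k v]|[[[s i] [[k f] a]]|[k v]]] //=.
rewrite /opT /opTkv /= /fst_part /snd_part /= mulrA mulVf ?mul1r//.
by rewrite gt_eqF// sqrtr_gt0 divr_gt0 ?varea_gt0 ?area_gt0.
Qed.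

Lemma linear_opTinv : linear opTinv.
Proof.
move=> r x y; apply/funext => -[kv|[[[s i] [[k f] a]]|kv]] //=.
by rewrite !fctE /GRing.scale /=; ring.
Qed.

(** As [T] is bijective, a form that is nonnegative on the feasible [z] is the
    image under the adjoint of a form that is nonnegative on [Q], that is, of a
    member of [Q]. *)
Lemma dual_cone_opT (y : zI M N -> R) :
  (forall z, coneQ (opT z) -> 0 <= dot z y) -> (adj opT @` coneQ) y.
Proof.
move=> h; exists (adj opTinv y).
  apply/coneQ_dual => x hx; rewrite -adjP; last exact: linear_opTinv.
  by apply: h; rewrite opTK.
apply: dot_ext => z.
rewrite -adjP; last exact: linear_opT.
by rewrite -adjP ?opTinvK//; exact: linear_opTinv.
Qed.

End Operators.

(** * Existence of an optimal primal-dual pair *)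

Section Optimality.
Context {R : realType} {M : mesh_data R} {N : nat}.
Hypothesis hM : is_mesh M.
Hypothesis hN : (1 <= N)%N.
Local Notation V := (vertex M).
Local Notation T := (face M).
Context (mu0 muN : V -> R).
Hypothesis hmu0 : is_density mu0.
Hypothesis hmuN : is_density muN.
Context (c : Vc M N -> R).
Hypothesis hc : forall phi : Vc M N -> R,
  dot_cV phi c = \sum_v varea v * phi (ord0, v) * mu0 v
                 - \sum_v varea v * phi (ord_max, v) * muN v.

Let N_gt0 : 0 < N%:R :> R. Proof. by rewrite ltr0n. Qed.

(** The hat functions of a triangle add up to 1. *)
Lemma sum_hat_grad (f : T) a : \sum_(i < 3) hat_grad f a i = 0.
Proof.
have D1 : (row_mx (const_mx (-1) : 'cV[R]_2) 1%:M : 'M[R]_(2, 3)) *m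
    (const_mx 1 : 'cV[R]_3) = 0.
  have -> : const_mx 1 = col_mx (const_mx 1 : 'cV[R]_1) (const_mx 1 : 'cV[R]_2).
    by rewrite col_mx_const.
  etransitivity; first exact: (@mul_row_col _ 2 1 2 1).
  by rewrite mul1mx; apply/colP => k; rewrite !mxE big_ord1 !mxE mulr1 addrC subrr.
have /matrixP/(_ a 0) : hat_grad f *m (const_mx 1 : 'cV[R]_3) = 0.
  by rewrite /hat_grad -mulmxA D1 mulmx0.
by rewrite mxE [RHS]mxE; under eq_bigr do rewrite [const_mx _ _ _]mxE mulr1.
Qed.

Lemma opAs_eq0 (phi : Vc M N -> R) : opAs phi = 0 -> forall k v v', phi (k, v) = phi (k, v').
Proof.
move=> h k; apply: (@mesh_const _ _ hM (fun v => phi (k, v))) => f.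
by apply: (@hat_grad_eq0 _ _ hM f (fun i => phi (k, corner f i))) => a;
  have := congr1 (fun y : Tc3 M N -> R => y ((k, f), a)) h.
Qed.

Lemma vertex_exists : exists v : V, True.
Proof.
have [_ s1] := hmu0; apply/not_existsP => noV.
have : \sum_v varea v * mu0 v = 0 by rewrite big1 // => v _; case: (noV v).
by rewrite s1 => /eqP; rewrite oner_eq0.
Qed.

Let tot : R := \sum_v @varea R M v.

Lemma tot_gt0 : 0 < tot.
Proof.
have [v _] := vertex_exists; rewrite /tot (bigD1 v)//= ltr_pwDl ?varea_gt0//.
by apply: sumr_ge0 => u _; rewrite ltW// varea_gt0.
Qed.

(** The density of total mass 1 that is constant in space and time, times the
    weights of [WstV]. *)
Definition uniform_mass (p : Vst M N) : R := varea p.2 / (N%:R * tot).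

Lemma uniform_mass_gt0 p : 0 < uniform_mass p.
Proof. by rewrite divr_gt0 ?varea_gt0 ?mulr_gt0 ?tot_gt0. Qed.

Lemma dot_cVC (x x' : Vc M N -> R) : dot_cV x x' = dot_cV x' x.
Proof. by apply: eq_bigr => -[k v] _ /=; ring. Qed.

Lemma dot_cV_WcV (phi : Vc M N -> R) : dot (WcV c) phi = dot_cV phi c.
Proof. exact: dotC. Qed.

(** The discrete continuity equation for the uniform density.  The form [e]
    below is the defect that a flux has to balance; it vanishes on potentials
    that are constant in space because both marginals have mass 1, hence it
    factors through the spatial gradient. *)
Lemma uniform_flow_exists : exists mu : Tc3 M N -> R, forall phi,
  dot (WcV c) phi = - (\sum_p uniform_mass p * opAt phi p) - dot (opAs phi) mu.
Proof.
have [L [linL LK _]] := linear_pinv (@linear_opAs R M N).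
pose e := WcV c + adj opAt uniform_mass.
have eE phi : dot phi e = dot (WcV c) phi + \sum_p uniform_mass p * opAt phi p.
  rewrite dotDr (dotC phi) -adjP; last exact: linear_opAt.
  by rewrite (dotC (opAt phi)).
have e_const phi : opAs phi = 0 -> dot phi e = 0.
  move=> /opAs_eq0 phic; have [v0 _] := vertex_exists.
  pose h n := phi (inord n, v0).
  rewrite eE dot_cV_WcV hc.
  have -> : \sum_v varea v * phi (ord0, v) * mu0 v = h 0%N.
    rewrite -[RHS]mulr1 -hmu0.2 mulr_sumr; apply: eq_bigr => v _.
    have -> : ord0 = inord 0 :> 'I_N.+1 by apply: val_inj; rewrite /= inordK.
    by rewrite (phic _ v v0) /h mulrA (mulrC (varea v)).
  have -> : \sum_v varea v * phi (ord_max, v) * muN v = h N.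
    rewrite -[RHS]mulr1 -hmuN.2 mulr_sumr; apply: eq_bigr => v _.
    have -> : ord_max = inord N :> 'I_N.+1 by apply: val_inj; rewrite /= inordK.
    by rewrite (phic _ v v0) /h mulrA (mulrC (varea v)).
  (* For a potential that is constant in space the time differences telescope. *)
  have -> : \sum_p uniform_mass p * opAt phi p =
      \sum_(k < N) \sum_(v : V) varea v * ((h k.+1 - h k) / tot).
    rewrite pair_bigA /=; apply: eq_bigr => -[k v] _; rewrite /uniform_mass /opAt /=.
    rewrite (phic _ v v0) (phic (before k) v v0) /h.
    have -> : after k = inord k.+1.
      by apply: val_inj; rewrite /= inordK// ltnS.
    have -> : before k = inord k.
      by apply: val_inj; rewrite /= inordK// ltnS ltnW.
    by field; rewrite !gt_eqF ?tot_gt0.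
  under eq_bigr do rewrite -mulr_suml -/tot mulrC divfK ?gt_eqF ?tot_gt0//.
  rewrite -(big_mkord xpredT (fun k => h k.+1 - h k)) telescope_sumr//.
  ring.
exists (- adj L e) => phi.
have : dot (phi - L (opAs phi)) e = 0.
  apply: e_const; rewrite linear_famB ?LK ?subrr//; exact: linear_opAs.
rewrite dotBl (adjP _ _ linL) eE dotNr => h.
by move: h; set x := \sum_p _; lra.
Qed.

(** The middle part of the block of [T B F q] at [p], between its first and
    last components [- q p] and [q p]. *)
Definition side_form (p : Vst M N) (y : Vst M N + Tc3 M N -> R) : side_index p -> R :=
  fst_part (snd_part (@opTkv R M N p (opBF y))).
Arguments side_form : clear implicits.

Lemma linear_side_form p : linear (side_form p).
Proof.
move=> r x y; apply/funext => j.
rewrite /side_form linear_opBF.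
have := linear_opT r (opBF x) (opBF y) => /(congr1 (fun t : TI M N -> R =>
  t (@Tagged _ p (fun kv : Vst M N => blockI kv.2) (inr (inl j))))).
by [].
Qed.

Let D p (phi : Vc M N -> R) : side_index p -> R := pulled_form (@opAt R M N) opAs side_form p phi.
Arguments D : clear implicits.

(** Every centered time is a neighbour of some staggered time, so every
    coordinate of the spatial gradient occurs, up to a factor, in some block. *)
Lemma side_form_cover (j : Tc3 M N) : exists C, 0 <= C /\ forall phi,
  opAs phi j ^+ 2 <= C * \sum_p uniform_mass p * dot (D p phi) (D p phi).
Proof.
case: j => [[k f] a].
have [k' [s ks]] : exists (k' : 'I_N) (s : bool), k = if s then after k' else before k'.
  have [kN|] := ltnP k N; first by exists (Ordinal kN), false; apply: val_inj.
  move=> Nk; have kN : (k : nat) = N by apply/eqP; rewrite eqn_leq Nk -ltnS ltn_ord.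
  have lt : (N.-1 < N)%N by rewrite prednK.
  by exists (Ordinal lt), true; apply: val_inj; rewrite /= kN /bump /= add1n prednK.
pose p : Vst M N := (k', corner f 0).
pose x : side_index p := exist (fun x : six * (T * 'I_3) => corner x.2.1 x.1.2 == corner f 0)
  ((s, 0), (f, a)) (eqxx _).
pose t := Num.sqrt (area f / varea (corner f 0)) * (Num.sqrt 3 / 3).
have t_gt0 : 0 < t.
  apply: mulr_gt0; last by rewrite divr_gt0// sqrtr_gt0.
  by rewrite sqrtr_gt0 divr_gt0 ?area_gt0 ?varea_gt0.
have DE phi : D p phi x = t * opAs phi ((k, f), a).
  by rewrite ks /t -[RHS]mulrA.
exists ((uniform_mass p * t ^+ 2)^-1); split.
  by rewrite invr_ge0 mulr_ge0 ?sqr_ge0// ltW// uniform_mass_gt0.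
move=> phi; rewrite ler_pdivlMl; last by rewrite mulr_gt0 ?exprn_gt0 ?uniform_mass_gt0.
rewrite -mulrA -exprMn -DE (bigD1 p)//=.
apply: (@le_trans _ _ (uniform_mass p * dot (D p phi) (D p phi))).
  by rewrite ler_pM2l ?uniform_mass_gt0// sqr_le_dot.
by rewrite lerDl sumr_ge0// => p' _; rewrite mulr_ge0 ?dot_ge0// ltW// uniform_mass_gt0.
Qed.

(** The potential minus [k] at time [k] decreases in time and has no spatial
    gradient. *)
Lemma slater_point : exists phi, forall p, constr (@opAt R M N) D p phi < 0.
Proof.
pose phi : Vc M N -> R := fun kv => - (nat_of_ord kv.1)%:R; exists phi => p.
have S0 : opAs phi = 0.
  apply/funext => -[[k f] a].
  transitivity (- k%:R * \sum_(i < 3) hat_grad f a i : R); last by rewrite sum_hat_grad mulr0.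
  by rewrite mulr_sumr.
rewrite /constr; have -> : D p phi = 0.
  apply/funext => -[[[s i] [f a]] h].
  have SE j : opAs phi j = 0 by rewrite S0.
  rewrite [LHS](_ : _ = Num.sqrt (area f / varea p.2) * (Num.sqrt 3 / 3 *
    opAs phi (((if s then after p.1 else before p.1), f), a)))//.
  by rewrite SE !mulr0.
case: p => k v; rewrite dot0l mul0r addr0 /opAt /=.
have -> : phi (after k, v) - phi (before k, v) = -1.
  rewrite /phi (_ : nat_of_ord (after k) = k.+1) // -natr1 /=; ring.
by rewrite mulrN1 oppr_lt0.
Qed.

Lemma opTkv_BF (q : qI M N -> R) kv : @opTkv R M N kv (opBF q) =
  stack (fun=> - q (inl kv)) (stack (side_form kv q) (fun=> q (inl kv))).
Proof. by apply/funext => -[[]|[x|[]]]. Qed.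

Lemma opTkv_BFd (q : qI M N -> R) kv : @opTkv R M N kv (opBF q + vd) =
  stack (fun=> 1 - q (inl kv)) (stack (side_form kv q) (fun=> 1 + q (inl kv))).
Proof.
apply/funext => -[[]|[x|[]]].
- by rewrite /= addrC.
- case: x => [[s [f a]] h].
  by rewrite /side_form /opTkv /fst_part /snd_part /= fctE /= addr0.
- by rewrite /= addrC.
Qed.

(** At a point [phi] with multipliers [m], the conic multiplier in the block
    [kv] is [m kv / 2] times the reflection [(z0; - zbar)] of the block [(z0; zbar)]
    of [T z]: it lies in the cone, it is orthogonal to the block when
    [m kv * constr kv phi = 0], and its product with [T B F A psi] is minus
    [m kv] times the derivative of the constraint. *)
Theorem optimal_pair_exists : exists phi alpha beta,
  [/\ coneQ (opT (opBF (opA phi) + vd)),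
      forall psi, dot_q (opA psi) alpha = - dot_cV c psi,
      forall q, dot_q q alpha + dot_z (opBF q) beta = 0 &
      forall z, coneQ (opT z) -> 0 <= dot_z (z - (opBF (opA phi) + vd)) beta].
Proof.
have [mu muP] := uniform_flow_exists.
have [phi [m [m_ge0 g_le0 mg0 stat]]] := coercive_multipliers (@linear_opAt R M N)
  (@linear_opAs R M N) linear_side_form uniform_mass_gt0 muP side_form_cover slater_point.
pose zs := opBF (opA phi) + vd.
pose y (t : TI M N) : R := m (tag t) / 2 *
  stack (fun=> 1 - opAt phi (tag t))
    (- stack (D (tag t) phi) (fun=> 1 + opAt phi (tag t))) (tagged t).
have blky kv : block_part y = (m kv / 2) *: stack (fun=> 1 - opAt phi kv)
    (- stack (D kv phi) (fun=> 1 + opAt phi kv)) by [].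
have gE kv : constr (@opAt R M N) D kv phi = opAt phi kv + dot (D kv phi) (D kv phi) / 4 by [].
have blk_snd (J : finType) (x : J -> R) (r : R) :
    dot (stack x (fun _ : unit => r)) (stack x (fun _ : unit => r)) = dot x x + r * r.
  by rewrite dot_stack {2}/dot (big_pred1 tt)//= => -[].
have cone_blk kv : soc (stack (fun _ : unit => 1 - opAt phi kv)
    (stack (D kv phi) (fun _ : unit => 1 + opAt phi kv)) : blockI kv.2 -> R).
  rewrite /soc /= /enorm blk_snd.
  have g0 := g_le0 kv; rewrite gE in g0; have d0 := dot_ge0 (D kv phi).
  rewrite -[leRHS]ger0_norm; last by rewrite /fst_part /=; lra.
  (* [(1 - a)^2 - (1 + a)^2 - |D|^2 = - 4 (a + |D|^2 / 4)] is nonnegative. *)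
  rewrite -sqrtr_sqr; apply: ler_wsqrtr; rewrite /fst_part /= -!expr2; lra.
have Tz kv : block_part (opT zs) = stack (fun _ : unit => 1 - opAt phi kv)
    (stack (D kv phi) (fun _ : unit => 1 + opAt phi kv)) :> (blockI kv.2 -> R).
  exact: opTkv_BFd.
have coneTz : coneQ (opT zs) by move=> kv; have := cone_blk kv; rewrite -Tz.
have coney : coneQ y.
  move=> kv; rewrite /soc /= -/(block_part y) blky.
  have -> : snd_part ((m kv / 2) *: stack (fun _ : unit => 1 - opAt phi kv)
      (- stack (D kv phi) (fun _ : unit => 1 + opAt phi kv))) =
      (m kv / 2) *: - stack (D kv phi) (fun _ : unit => 1 + opAt phi kv) by [].
  rewrite /enorm dotZl dotZr mulrA -expr2 sqrtrM ?sqr_ge0// sqrtr_sqr ger0_norm; last first.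
    by rewrite divr_ge0.
  rewrite /fst_part /=; apply: ler_wpM2l; first by rewrite divr_ge0.
  by have := cone_blk kv; rewrite /soc /= -enormN.
have compl : dot (opT zs) y = 0.
  rewrite dot_TI big1// => kv _; rewrite blky Tz dotZr dot_stack dotNr blk_snd.
  rewrite /dot (big_pred1 tt)/=; last by case.
  rewrite -/(dot (D kv phi) (D kv phi)).
  have := mg0 kv; rewrite gE; lra.
have pair psi : dot (opT (opBF (opA psi))) y = dot (WcV c) psi.
  have := stat psi; rewrite addrC => /eqP; rewrite addr_eq0 => /eqP/esym/eqP.
  rewrite eqr_oppLR => /eqP ->; rewrite -sumrN dot_TI; apply: eq_bigr => kv _.
  have -> : block_part (opT (opBF (opA psi))) = @opTkv R M N kv (opBF (opA psi)) by [].
  rewrite opTkv_BF blky dotZr dot_stack dotNr dot_stack.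
  rewrite {1}/dot (big_pred1 tt)/=; last by case.
  rewrite {2}/dot (big_pred1 tt)/=; last by case.
  rewrite /dconstr -/(D kv psi) (dotC (D kv psi)); lra.
pose Wb := adj opT y; pose Wa := - adj opBF Wb.
pose beta i := (wz i)^-1 * Wb i; pose alpha i := (wq i)^-1 * Wa i.
have dz z : dot_z z beta = dot (opT z) y.
  rewrite /dot_z WzE; have -> : weigh wz beta = Wb.
    by apply/funext => i; rewrite /weigh /beta mulVKf// gt_eqF// wz_gt0.
  by rewrite /Wb -(adjP _ _ (@linear_opT R M N)).
have dq q : dot_q q alpha = - dot_z (opBF q) beta.
  rewrite /dot_q WqE; have -> : weigh wq alpha = Wa.
    by apply/funext => i; rewrite /weigh /alpha mulVKf// gt_eqF// wq_gt0.
  by rewrite dotNr -(adjP _ _ (@linear_opBF R M N)) dz (adjP _ _ (@linear_opT R M N)).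
exists phi, alpha, beta; split => //.
- by move=> psi; rewrite dq dz pair dot_cV_WcV dot_cVC.
- by move=> q; rewrite dq addNr.
- move=> z coneTz'; rewrite dz linear_famB; last exact: linear_opT.
  by rewrite dotBl compl subr0; exact: (coneQ_dual y).1.
Qed.

End Optimality.

(** * Optimality conditions of the two minimization steps *)

Section Lagrangian.
Context {R : realType} {M : mesh_data R} {N : nat}.
Hypothesis hM : is_mesh M.
Hypothesis hN : (1 <= N)%N.
Context (c : Vc M N -> R) (sigma : R).

(** The weights of [<., .>_q] and [<., .>_z] on the space of the pairs
    [(a, z)] that contains both constraint residuals. *)
Definition pair_weight : qI M N + zI M N -> R := stack wq wz.
Definition offset : qI M N + zI M N -> R := stack 0 vd.
Definition q_image (q : qI M N -> R) : qI M N + zI M N -> R := stack q (opBF q).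
Local Notation "<| x , y |>" := (wdot pair_weight x y).

Lemma pair_weight_gt0 i : 0 < pair_weight i.
Proof. by case: i => i; [exact: wq_gt0|exact: wz_gt0]. Qed.

Lemma wdot_stack a z al be : <|stack a z, stack al be|> = dot_q a al + dot_z z be.
Proof.
rewrite /dot_q /dot_z WqE WzE -dot_stack; congr dot.
by apply/funext => -[].
Qed.

Lemma linear_q_image : linear q_image.
Proof. by move=> r x y; rewrite /q_image linear_opBF; apply/funext => -[]. Qed.

Lemma stackD (I J : Type) (x x' : I -> R) (y y' : J -> R) :
  stack x y + stack x' y' = stack (x + x') (y + y').
Proof. by apply/funext => -[]. Qed.

Lemma stackZ (I J : Type) (a : R) (x : I -> R) (y : J -> R) :
  a *: stack x y = stack (a *: x) (a *: y).
Proof. by apply/funext => -[]. Qed.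

Lemma stackB (I J : Type) (x x' : I -> R) (y y' : J -> R) :
  stack x y - stack x' y' = stack (x - x') (y - y').
Proof. by apply/funext => -[]. Qed.

Definition lagrangian (phi : Vc M N -> R) (r y : qI M N + zI M N -> R) : R :=
  dot_cV c phi + <|r, y|> + sigma / 2 * <|r, r|>.

Definition residual (phi : Vc M N -> R) (z : zI M N -> R) (q : qI M N -> R) :
    qI M N + zI M N -> R :=
  stack (opA phi) z - q_image q - offset.

Lemma aug_lagrangianE phi z q alpha beta : aug_lagrangian c sigma phi z q alpha beta =
  if `[< coneQ (opT z) >] then (lagrangian phi (residual phi z q) (stack alpha beta))%:E else +oo%E.
Proof.
have rE : residual phi z q = stack (opA phi - q) (z - opB (opF q) - vd).
  by rewrite /residual /q_image !stackB subr0.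
have dq0 (x : qI M N -> R) : 0 <= dot_q x x.
  by rewrite /dot_q WqE; apply: wdot_ge0; exact: wq_gt0.
have dz0 (x : zI M N -> R) : 0 <= dot_z x x.
  by rewrite /dot_z WzE; apply: wdot_ge0; exact: wz_gt0.
rewrite /aug_lagrangian /indicator; case: asboolP => // _.
rewrite /lagrangian rE !wdot_stack /norm_q /norm_z !sqr_sqrtr//.
by rewrite adde0 -!EFinD; congr EFin; ring.
Qed.

Lemma lagrangianD phi psi r d y t :
  lagrangian (phi + t *: psi) (r + t *: d) y = lagrangian phi r y +
   (t * (dot_cV c psi + <|d, y + sigma *: r|>) + t ^+ 2 * (sigma / 2 * <|d, d|>)).
Proof.
rewrite /lagrangian.
have -> : dot_cV c (phi + t *: psi) = dot_cV c phi + t * dot_cV c psi.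
  by rewrite !(dot_cVC c) /dot_cV dotDl dotZl.
rewrite !(wdotDl, wdotDr, wdotZl, wdotZr) (wdotC _ r d).
by field.
Qed.

(** The [(phi, z)]-step as a variational inequality on the feasible set.  The
    value is finite at [z = 0], so the minimizer is feasible. *)
Lemma argmin_phiz phi z q alpha beta :
  is_argmin [set p : (Vc M N -> R) * (zI M N -> R) | range (adj opA) p.1]
    (fun p => aug_lagrangian c sigma p.1 p.2 q alpha beta) (phi, z) ->
  [/\ range (adj opA) phi, coneQ (opT z) & forall phi' z',
    range (adj opA) phi' -> coneQ (opT z') ->
    0 <= dot_cV c (phi' - phi) + <|stack (opA phi') z' - stack (opA phi) z,
      stack alpha beta + sigma *: residual phi z q|>].
Proof.
case=> /= rphi mini.
have coneTz : coneQ (opT z).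
  have := mini (phi, 0) rphi; rewrite !aug_lagrangianE /=.
  rewrite (linear_fam0 (@linear_opT R M N)) (asboolT (coneQ0 (M := M) (N := N))).
  by case: asboolP.
split=> // phi' z' rphi' coneTz'.
apply: (@linear_ineq_slope _ _ (sigma / 2 * <|stack (opA phi') z' - stack (opA phi) z,
  stack (opA phi') z' - stack (opA phi) z|>)) => t /andP[t0 t1].
have cone_t : coneQ (opT (z + t *: (z' - z))).
  have -> : z + t *: (z' - z) = (1 - t) *: z + t *: z'.
    by rewrite scalerBr scalerBl scale1r addrA addrAC.
  rewrite (linear_famD _ _ (@linear_opT R M N)) !(linear_famZ _ _ (@linear_opT R M N)).
  by apply: coneQ_comb => //; rewrite ?subr_ge0// ltW.
have range_t : range (adj opA) (phi + t *: (phi' - phi)).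
  case: rphi => x _ <-; case: rphi' => x' _ <-; exists (x + t *: (x' - x)) => //.
  by rewrite (linear_famD _ _ (linear_adj _)) (linear_famZ _ _ (linear_adj _))
    (linear_famB _ _ (linear_adj _)).
have := mini (phi + t *: (phi' - phi), z + t *: (z' - z)) range_t.
rewrite !aug_lagrangianE /= !asboolT// lee_fin.
have -> : residual (phi + t *: (phi' - phi)) (z + t *: (z' - z)) q =
    residual phi z q + t *: (stack (opA phi') z' - stack (opA phi) z).
  rewrite /residual (linear_famD _ _ (@linear_opA R M N)) (linear_famZ _ _ (@linear_opA R M N)).
  rewrite (linear_famB _ _ (@linear_opA R M N)) (stackB (opA phi')) stackZ -stackD.
  by rewrite -!addrA; congr (_ + _); rewrite addrC -!addrA.
by rewrite lagrangianD lerDl.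
Qed.

(** The [q]-step is an unconstrained quadratic minimization, so its optimality
    condition is an orthogonality relation. *)
Lemma argmin_q phi z q alpha beta : coneQ (opT z) ->
  is_argmin [set: qI M N -> R]
    (fun q' => aug_lagrangian c sigma phi z q' alpha beta) q ->
  forall v, <|q_image v, stack alpha beta + sigma *: residual phi z q|> = 0.
Proof.
move=> coneTz [_ mini].
have half v : 0 <= - <|q_image v, stack alpha beta + sigma *: residual phi z q|>.
  apply: (@linear_ineq_slope _ _ (sigma / 2 * <|- q_image v, - q_image v|>)) => t _.
  have := mini (q + t *: v) I; rewrite !aug_lagrangianE /= !asboolT// lee_fin.
  have -> : residual phi z (q + t *: v) = residual phi z q + t *: - q_image v.
    rewrite /residual (linear_famD _ _ linear_q_image) (linear_famZ _ _ linear_q_image).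
    by rewrite opprD scalerN -!addrA (addrC (- offset)).
  have c0 : dot_cV c 0 = 0 by rewrite dot_cVC /dot_cV dot0l.
  have := lagrangianD phi 0 (residual phi z q) (- q_image v) (stack alpha beta) t.
  by rewrite scaler0 addr0 c0 add0r wdotNl => ->; rewrite lerDl.
move=> v; apply/eqP; rewrite eq_le -oppr_ge0 half/=.
have := half (- v).
have -> : q_image (- v) = - q_image v.
  by rewrite -[- v]scaleN1r (linear_famZ _ _ linear_q_image) scaleN1r.
by rewrite wdotNl opprK.
Qed.

End Lagrangian.

Lemma tends_unshift (R : realType) (I : finType) (u : nat -> I -> R) x :
  tends (u \o S) x -> tends u x.
Proof. by move=> h i; have := h i; rewrite /= (cvg_shiftS (fun n => u n i)). Qed.

(** * Convergence *)

Theorem theorem5p1 (R : realType) (M : mesh_data R) (hM : is_mesh M)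
    (N : nat) (hN : (1 <= N)%N)
    (mu0 muN : vertex M -> R) (hmu0 : is_density mu0) (hmuN : is_density muN)
    (c : Vc M N -> R)
    (hc : forall phi : Vc M N -> R,
      dot_cV phi c = \sum_v varea v * phi (ord0, v) * mu0 v
                     - \sum_v varea v * phi (ord_max, v) * muN v)
    (sigma tau : R) (hsigma : 0 < sigma) (htau : 0 < tau < 2)
    (phi : nat -> Vc M N -> R) (z : nat -> zI M N -> R)
    (q alpha : nat -> qI M N -> R) (beta : nat -> zI M N -> R)
    (hphiz : forall l : nat,
      is_argmin [set p : (Vc M N -> R) * (zI M N -> R) | range (adj opA) p.1]
        (fun p => aug_lagrangian c sigma p.1 p.2 (q l) (alpha l) (beta l))
        (phi l.+1, z l.+1))
    (hq : forall l : nat,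
      is_argmin [set: qI M N -> R]
        (fun q' => aug_lagrangian c sigma (phi l.+1) (z l.+1) q' (alpha l) (beta l))
        (q l.+1))
    (halpha : forall l : nat,
      alpha l.+1 = alpha l + (tau * sigma) *: (opA (phi l.+1) - q l.+1))
    (hbeta : forall l : nat,
      beta l.+1 = beta l + (tau * sigma) *: (z l.+1 - opB (opF (q l.+1)) - vd)) :
  exists (phi' : Vc M N -> R) (z' : zI M N -> R) (q' alpha' : qI M N -> R)
      (beta' : zI M N -> R),
    is_KKT c phi' z' q' alpha' beta' /\
    [/\ {ptws, phi @ \oo --> phi'}, {ptws, z @ \oo --> z'}, {ptws, q @ \oo --> q'},
        {ptws, alpha @ \oo --> alpha'} & {ptws, beta @ \oo --> beta'}].
Proof.
have [phis [alphas [betas [coneTs cA optq optz]]]] := optimal_pair_exists hM hN hmu0 hmuN hc.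
have linA := @linear_opA R M N.
have linT := @linear_opT R M N.
have [inv [lin_inv invK inv_range]] := linear_pinv linA.
have inv_opA x : range (adj opA) x -> inv (opA x) = x.
  case=> y _ <-; have [y' _ y'E] := inv_range (opA (adj opA y)).
  apply/esym/eqP; rewrite -subr_eq0; apply/eqP/dot_eq0.
  rewrite -{2}y'E -(linear_famB _ _ (linear_adj _)) -adjP// (linear_famB _ _ linA) invK subrr.
  exact: dot0l.
(* The spaces of the splitting; membership of [fst_part p] in the range of
   [opA] is written with the generalized inverse, so that it is closed. *)
pose K := (qI M N + zI M N)%type.
pose w : K -> R := pair_weight.
pose C := [set p : K -> R | opA (inv (fst_part p)) = fst_part p /\ coneQ (opT (snd_part p))].
pose U := [set u : K -> R | u = q_image (fst_part u)].
pose s : K -> R := stack (- alphas) 0.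
pose p l : K -> R := stack (opA (phi l)) (z l).
pose u l : K -> R := q_image (q l).
pose y l : K -> R := stack (alpha l) (beta l).
(* By [cA], the family [s] represents the linear objective. *)
have s_dot psi z' : wdot w (stack (opA psi) z') s = dot_cV c psi.
  rewrite wdot_stack dot_qE dot_zE wdotNr -dot_qE cA opprK.
  by rewrite -(scale0r (0 : zI M N -> R)) wdotZr mul0r addr0.
have phiz l := argmin_phiz hM hN (hphiz l).
have U_lin a x x' : U x -> U x' -> U (a *: x + x').
  by rewrite /U /= => Ux Ux'; rewrite {1}Ux {1}Ux' -linear_q_image.
have closedC x v : (forall n, C (x n)) -> tends x v -> C v.
  move=> Cx xv; split.
    have h := tends_linear linA (tends_linear lin_inv (tends_fst xv)).
    apply: tends_unique h _; rewrite (_ : (fun n => _) = fun n => fst_part (x n)).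
      exact: tends_fst.
    by apply/funext => n; exact: (Cx n).1.
  apply: (coneQ_closed (fun n => (Cx n).2)).
  exact: (tends_linear linT (tends_snd xv)).
have closedU x v : (forall n, U (x n)) -> tends x v -> U v.
  move=> Ux xv; apply: (tends_unique xv).
  rewrite (_ : x = fun n => q_image (fst_part (x n))).
    exact: (tends_linear (@linear_q_image R M N) (tends_fst xv)).
  by apply/funext => n; exact: Ux.
have p_in l : C (p l.+1) by have [_ coneTz _] := phiz l; split => //; exact: invK.
have u_in l : U (u l) by [].
have resE l l' : residual (phi l) (z l) (q l') = p l - u l' - offset by [].
have p_step l p' : C p' ->
    0 <= wdot w (p' - p l.+1) (s + (y l + sigma *: (p l.+1 - u l - offset))).
  move=> [fst_p' snd_p']; have [_ _ vi] := phiz l.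
  have := vi _ _ (inv_range (fst_part p')) snd_p'.
  rewrite fst_p' stack_parts => h; rewrite wdotDr.
  have -> : wdot w (p' - p l.+1) s = dot_cV c (inv (fst_part p') - phi l.+1).
    rewrite -(s_dot _ (snd_part p' - z l.+1)) (linear_famB _ _ linA) fst_p' -stackB.
    by rewrite stack_parts.
  exact: h.
have u_step l v : U v ->
    wdot w v (y l + sigma *: (p l.+1 - u l.+1 - offset)) = 0.
  move=> Uv; have [_ coneTz _] := phiz l.
  by have := argmin_q hM hN coneTz (hq l) (fst_part v); rewrite -Uv.
have y_step l : y l.+1 = y l + (tau * sigma) *: (p l.+1 - u l.+1 - offset).
  rewrite /y halpha hbeta /p /u /q_image /offset !stackB stackZ stackD subr0.
  by rewrite /opBF.
have sad : exists ps us ys, saddle w C U s offset ps us ys.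
  exists (stack (opA phis) (opBF (opA phis) + vd)), (q_image (opA phis)), (stack alphas betas).
  split.
  - by split => //; exact: invK.
  - by [].
  - by rewrite /q_image stackB subrr addrAC subrr add0r.
  - by move=> v ->; rewrite wdot_stack optq.
  - move=> p' [_ snd_p']; rewrite -[p']stack_parts stackB /s (stackD (- alphas)) addNr add0r.
    rewrite wdot_stack.
    rewrite [X in X + _](_ : _ = 0) ?add0r; first exact: optz.
    by rewrite dot_qE -(scale0r (0 : qI M N -> R)) wdotZr mul0r.
have [ps [us [ys [Sad ptend utend ytend]]]] := splitting_converges (pair_weight_gt0 hM hN)
  U_lin closedC closedU hsigma htau p_in u_in p_step u_step y_step sad.
have [[fst_ps cone_ps] Uus eq_ps orth_ys min_ps] := Sad.
have psE : ps = us + offset by rewrite -eq_ps addrC subrK.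
have fst_psE : fst_part ps = fst_part us.
  by rewrite psE; apply/funext => i; rewrite /fst_part fctE addr0.
have snd_psE : snd_part ps = opBF (fst_part us) + vd.
  by rewrite psE Uus.
(* The saddle inequality in terms of the original variables: the limit may
   be moved by any [opA psi] and to any feasible [z']. *)
have vi psi z' : coneQ (opT z') -> 0 <= dot_cV c psi + dot_q (opA psi) (fst_part ys)
    + dot_z (z' - snd_part ps) (snd_part ys).
  move=> cone_z'; have := min_ps (stack (fst_part ps + opA psi) z').
  have -> : stack (fst_part ps + opA psi) z' - ps = stack (opA psi) (z' - snd_part ps).
    by rewrite -[in X in _ - X](stack_parts ps) stackB addrAC subrr add0r.
  rewrite wdotDr s_dot -[in X in wdot _ _ X](stack_parts ys) wdot_stack addrA; apply.
  split => //; rewrite /fst_part /= -/(fst_part ps) -fst_ps.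
  by rewrite -(linear_famD _ _ linA) invK.
have vi_psi psi : 0 <= dot_cV c psi + dot_q (opA psi) (fst_part ys).
  have := vi psi _ cone_ps; rewrite subrr.
  by rewrite [X in _ + _ + X]dot0l addr0.
have vi_z z' : coneQ (opT z') -> 0 <= dot_z (z' - snd_part ps) (snd_part ys).
  move=> /(vi 0); rewrite (linear_fam0 linA) [dot_q _ _]dot0l dot_cVC [dot_cV _ _]dot0l.
  by rewrite !add0r.
have cone_dual z' : coneQ (opT z') -> 0 <= dot_z z' (snd_part ys).
  move=> cone_z'; have := vi_z (snd_part ps + z'); rewrite addrAC subrr add0r; apply.
  rewrite (linear_famD _ _ linT) -[opT (snd_part ps)]scale1r -[opT z']scale1r.
  exact: coneQ_comb.
exists (inv (fst_part ps)), (snd_part ps), (fst_part us), (fst_part ys), (snd_part ys).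
split.
  split.
  - by rewrite fst_ps fst_psE.
  - by rewrite snd_psE.
  - apply: dot_ext => psi; rewrite dot0r dotDr -(adjP _ _ linA).
    have := vi_psi psi; have := vi_psi (- psi).
    rewrite -[in - psi]scaleN1r (linear_famZ _ _ linA) ![dot_cV c _]dot_cVC.
    rewrite [dot_cV (-1 *: psi) _]dotZl [dot_q (-1 *: opA psi) _]dotZl /dot_cV /dot_q.
    move=> h1 h2; rewrite -/(Wq (fst_part ys)); lra.
  - apply: dot_ext => v; rewrite dot0r dotDr.
    rewrite -(adjP _ _ (@linear_opF R M N)) -(adjP _ _ (@linear_opB R M N)).
    have := orth_ys (q_image v); rewrite -[in X in wdot _ _ X](stack_parts ys) wdot_stack; exact.
  - exact: cone_ps.
  - exact: (dual_cone_opT hM cone_dual).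
  - apply/eqP; rewrite dot_zE wdotC -dot_zE eq_le cone_dual// andbT.
    have := vi_z 0; rewrite (linear_fam0 linT) sub0r dot_zE wdotNl -dot_zE oppr_ge0; apply.
    exact: coneQ0.
split; apply: tends_ptws.
- apply: tends_unshift; have := tends_linear lin_inv (tends_fst ptend).
  rewrite (_ : (fun n => _) = phi \o S)//; apply/funext => l /=.
  by rewrite inv_opA//; have [] := phiz l.
- by apply: tends_unshift; exact: tends_snd ptend.
- exact: tends_fst utend.
- exact: tends_fst ytend.
- exact: tends_snd ytend.
Qed.
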